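(* There exist absolute constants $0<c_1\le c_2$ such that for every instance $(G,\sigma,s,t)$ of Min-Color Path in which $G$ is planar, $(G,\sigma)$ is color-connected and $s,t$ are connected in $G$, we have $c_1\tau\le \mathrm{OPT}\le c_2\tau$, i.e. $\mathrm{OPT}=\Theta(\tau)$, where $\mathrm{OPT}$ is the minimum number of colors on an $s$-$t$ path and $\tau$ is the maximum value of a fractional packing of $s$-$t$ color separators.
   Context: Min-Color Path instance: a finite undirected graph $G=(V,E)$, coloring $\sigma:V\to 2^{[m]}$, vertices $s,t$; for a path $\pi$, $\sigma(\pi)=\bigcup_{v\in\pi}\sigma(v)$. $(G,\sigma)$ is color-connected if for each color $c$ the set of vertices whose color set contains $c$ induces a connected subgraph. For $C\subseteq[m]$ let $V(C)=\{v\in V:\sigma(v)\cap C\neq\emptyset\}$. A set $S\subseteq[m]$ is an $s$-$t$ color separator if there is no $s$-$t$ path in $G$ avoiding all vertices of $V(S)$. Let $\mathcal{F}$ be the family of all $s$-$t$ color separators. A fractional packing of color separators is an assignment $0\le y_S\le 1$ for $S\in\mathcal{F}$ with $\sum_{S\in\mathcal{F},\,c\in S}y_S\le 1$ for every color $c\in[m]$; its value is $\sum_{S\in\mathcal{F}}y_S$. *)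

(* Defs.v *)
From HB Require Import structures.
From mathcomp Require Import all_boot all_order all_algebra.
From mathcomp Require Import all_classical all_reals all_analysis.
From mathcomp Require Import Rstruct Rstruct_topology.
Set Implicit Arguments. Unset Strict Implicit. Unset Printing Implicit Defensive.
Import Order.TTheory GRing.Theory Num.Theory.
Local Open Scope ring_scope.

Notation realR := Rdefinitions.R.

Section MinColorPath.
Variables (V : finType) (e : rel V) (m : nat) (sigma : V -> {set 'I_m}).

Definition induced_rel (A : {set V}) : rel V :=
  fun x y => [&& e x y, x \in A & y \in A].

Definition st_path (s t : V) (p : seq V) : Prop :=
  path e s p /\ last s p = t /\ uniq (s :: p).

Definition path_colors (s : V) (p : seq V) : {set 'I_m} :=
  \bigcup_(v <- s :: p) sigma v.

Definition is_OPT (s t : V) (k : nat) : Prop :=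
  (exists p, st_path s t p /\ #|path_colors s p| = k) /\
  (forall p, st_path s t p -> (k <= #|path_colors s p|)%N).

Definition color_connected : Prop :=
  forall c : 'I_m, let A := [set v | c \in sigma v] in
    forall u w, u \in A -> w \in A -> connect (induced_rel A) u w.

Definition Vcol (C : {set 'I_m}) : {set V} := [set v | ~~ [disjoint sigma v & C]].

Definition is_separator (s t : V) (C : {set 'I_m}) : bool :=
  ~~ ((s \notin Vcol C) && connect (induced_rel (~: Vcol C)) s t).

Definition frac_packing (s t : V) (y : {set 'I_m} -> realR) : Prop :=
  (forall S, is_separator s t S -> 0 <= y S <= 1) /\
  (forall c : 'I_m, \sum_(S : {set 'I_m} | is_separator s t S && (c \in S)) y S <= 1).

Definition packing_value (s t : V) (y : {set 'I_m} -> realR) : realR :=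
  \sum_(S : {set 'I_m} | is_separator s t S) y S.

Definition is_tau (s t : V) (tau : realR) : Prop :=
  (exists y, frac_packing s t y /\ packing_value s t y = tau) /\
  (forall y, frac_packing s t y -> packing_value s t y <= tau).

End MinColorPath.

Local Open Scope classical_set_scope.
Definition planar (V : finType) (e : rel V) : Prop :=
  exists (pos : V -> realR * realR) (arc : V -> V -> realR -> realR * realR),
    injective pos /\
    (forall u v, e u v -> u != v ->
       [/\ {within [set x : realR | 0 <= x <= 1], continuous (arc u v)},
           arc u v 0 = pos u, arc u v 1 = pos v,
           {in [set x : realR | 0 <= x <= 1] &, injective (arc u v)}
         & forall x w, 0 < x < 1 -> arc u v x <> pos w]) /\
    (forall u v u' v', e u v -> u != v -> e u' v' -> u' != v' ->
       [set u; v] != [set u'; v'] ->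
       forall x x', 0 < x < 1 -> 0 < x' < 1 -> arc u v x <> arc u' v' x').

(* Main.v *)
Require Import Defs.
From HB Require Import structures.
From mathcomp Require Import all_boot all_order all_algebra.
From mathcomp Require Import all_classical all_reals all_analysis.
From mathcomp Require Import Rstruct Rstruct_topology.
From mathcomp Require Import ring lra zify.
Set Implicit Arguments. Unset Strict Implicit. Unset Printing Implicit Defensive.
Import Order.TTheory GRing.Theory Num.Theory.
Import numFieldNormedType.Exports.

(** A path of [G] avoiding the colors of a separator does not exist, so a path meets every separator
    and its colors pay for any packing: [tau <= OPT].

    Conversely, by linear programming duality there are weights on the colors with total
    at most [2 * tau] giving weight at least 1 to every separator.  A drawing of [G] is replaced by
    disjoint connected sets of cells of a fine triangular lattice, one per vertex, which touch exactly
    along the edges of [G].  Colors become connected sets of cells, and the unlabelled cells become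
    obstacles of weight zero.  A set of cells separates [s] from [t] exactly when it contains a closed
    walk of odd winding parity, so every odd closed walk of colors has weight at least 1.

    All heavy colors are deleted, at constant cost.  For every class of touching light colors,
    distances are measured from its last color on a fixed curve [q] from [s] to [t], and the class is
    chopped at regularly spaced distances; every resulting slab is chopped once more at some small
    distance from the first color of the slab on [q].  Random offsets make both chops cheap.  A piece near
    that first color is covered by short chains, two of which never carry an odd closed walk.  A piece
    far from it is avoided by the curve that follows [q] to the first color of the slab, then a shortest
    chain to the last color of the class, then [q] again.  Hence the remaining colors carry no odd
    closed walk and do not separate [s] from [t]. *)

(** * Node-weighted distances, reachability and parity *)

Section NodeWeightedDistance.
Variables (I : finType) (w : I -> nat) (R : rel I).

Definition cost (p : seq I) : nat := \sum_(i <- p) w i.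

Lemma cost_cons i p : cost (i :: p) = w i + cost p.
Proof. by rewrite /cost big_cons. Qed.

Lemma cost_cat p q : cost (p ++ q) = cost p + cost q.
Proof. by rewrite /cost big_cat. Qed.

(** [d i] is the least cost of a chain from [rho i] to [i], both ends counted. A prefix of a
    shortest chain is itself shortest, since a cheaper one could replace it; this gives the last
    clause. *)
Lemma root_distance (rho : I -> I) :
  (forall i, connect R (rho i) i) -> (forall i j, R i j -> rho i = rho j) ->
  exists d : I -> nat,
  [/\ forall i, rho i = i -> d i = w i,
      forall i j, R i j -> d j <= d i + w j
    & forall i, exists p, [/\ path R (rho i) p, last (rho i) p = i &
        forall p1 p2, p = p1 ++ p2 -> cost (rho i :: p1) = d (last (rho i) p1)]].
Proof.
move=> rho_conn rho_eq.
have rho_path i p : path R i p -> rho (last i p) = rho i.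
  by elim: p i => //= j p IHp i /andP[/rho_eq -> /IHp].
pose P i n := `[< exists p, [/\ path R (rho i) p, last (rho i) p = i & cost (rho i :: p) = n] >].
have exP i : exists n, P i n.
  by have /connectP[p pP /esym lp] := rho_conn i; exists (cost (rho i :: p)); apply/asboolP; exists p.
pose d i := ex_minn (exP i).
have dP i : exists p, [/\ path R (rho i) p, last (rho i) p = i & cost (rho i :: p) = d i].
  by rewrite /d; case: ex_minnP => n /asboolP.
have dmin i p : path R (rho i) p -> last (rho i) p = i -> d i <= cost (rho i :: p).
  by move=> pP lp; rewrite /d; case: ex_minnP => n _; apply; apply/asboolP; exists p.
have dstep i j : R i j -> d j <= d i + w j.
  move=> Rij; have [p [pP lp <-]] := dP i.
  have := dmin j (rcons p j); rewrite -(rho_eq _ _ Rij) rcons_path pP lp last_rcons => /(_ Rij erefl).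
  by rewrite -rcons_cons -cats1 cost_cat cost_cons /cost !big_cons big_nil addn0.
have dpath i p : path R i p -> d (last i p) <= d i + cost p.
  elim: p i => [|j p IHp] i /=; first by rewrite leq_addr.
  case/andP=> /dstep dj /IHp /leq_trans; apply.
  by rewrite cost_cons addnA leq_add2r.
exists d; split=> //.
  move=> i ri; have := dmin i [::]; rewrite ri => /(_ erefl erefl).
  have [p [_ _ <-]] := dP i; rewrite ri !cost_cons /cost big_nil addn0 => pw.
  by apply/eqP; rewrite eqn_leq pw leq_addr.
move=> i; have [p [pP lp cp]] := dP i; exists p; split=> // p1 p2 def_p.
apply/eqP; rewrite eqn_leq; apply/andP; split; last first.
  have p1P : path R (rho i) p1 by move: pP; rewrite def_p cat_path => /andP[].
  have rl : rho (last (rho i) p1) = rho i by rewrite rho_path // -(rho_path _ _ pP) lp.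
  by have := dmin (last (rho i) p1) p1; rewrite rl; apply.
have := dpath (last (rho i) p1) p2; move: pP lp cp.
rewrite def_p cat_path last_cat -cat_cons cost_cat => /andP[_ p2P] -> <- /(_ p2P).
by rewrite leq_add2r.
Qed.

End NodeWeightedDistance.

Section Reach.
Variables (T : Type) (nb : T -> T -> Prop).

Inductive reach (A : T -> Prop) (a : T) : T -> Prop :=
| reach_refl : A a -> reach A a a
| reach_step b c : reach A a b -> nb b c -> A c -> reach A a c.

Lemma reach_trans A a b c : reach A a b -> reach A b c -> reach A a c.
Proof. by move=> ab; elim=> // b' c' _ ab' bc Ac; apply: reach_step ab' bc Ac. Qed.

Lemma reach_mono (A B : T -> Prop) a b :
  (forall z, A z -> B z) -> reach A a b -> reach B a b.
Proof.
move=> AB; elim=> [/AB Ba|b' c _ ab bc /AB Bc]; first exact: reach_refl.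
exact: reach_step ab bc Bc.
Qed.

Lemma reach_in A a b : reach A a b -> A a /\ A b.
Proof. by elim=> // b' c _ [Aa _] _ Ac. Qed.

Lemma reach1 (A : T -> Prop) a b : A a -> A b -> nb a b -> reach A a b.
Proof. by move=> Aa Ab ab; apply: reach_step ab Ab; apply: reach_refl. Qed.

Lemma reach_fun (A : T -> Prop) (q : nat -> T) m n :
  (forall k, nb (q k) (q k.+1)) -> m <= n ->
  (forall k, m <= k <= n -> A (q k)) -> reach A (q m) (q n).
Proof.
move=> nbq /subnKC <-; elim: (n - m) => [|l IHl] Aq.
  by rewrite addn0; apply: reach_refl; apply: Aq; lia.
rewrite addnS; apply: (@reach_step _ _ (q (m + l))) => //.
  by apply: IHl => k km; apply: Aq; lia.
by rewrite -addnS; apply: Aq; lia.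
Qed.

Definition joined (A : T -> Prop) := forall a b, A a -> A b -> reach A a b.

Hypothesis nb_sym : forall a b, nb a b -> nb b a.

Lemma reach_sym A a b : reach A a b -> reach A b a.
Proof.
elim=> [Aa|b' c ab' b'a bc Ac]; first exact: reach_refl.
have [_ Ab'] := reach_in ab'.
exact: reach_trans (reach1 Ac Ab' (nb_sym bc)) b'a.
Qed.

Lemma joined_or (A B : T -> Prop) a b :
  joined A -> joined B -> A a -> B b -> nb a b -> joined (fun z => A z \/ B z).
Proof.
move=> jA jB Aa Bb ab.
have AU z : A z -> reach (fun z => A z \/ B z) a z.
  by move=> Az; apply: reach_mono (jA _ _ Aa Az); left.
have BU z : B z -> reach (fun z => A z \/ B z) a z.
  move=> Bz; apply: (@reach_trans _ _ b); first by apply: reach1; [left|right|].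
  by apply: reach_mono (jB _ _ Bb Bz); right.
have U z : A z \/ B z -> reach (fun z => A z \/ B z) a z by case; [apply: AU|apply: BU].
by move=> x y /U ax /U ay; apply: reach_trans (reach_sym ax) ay.
Qed.

End Reach.

Section Parity.
Variables (T : Type) (nb : T -> T -> Prop) (lam : T -> T -> bool).
Hypothesis nb_refl : forall a, nb a a.
Hypothesis nb_sym : forall a b, nb a b -> nb b a.

Definition potential (U : T -> Prop) (f : T -> bool) :=
  forall a b, U a -> U b -> nb a b -> lam a b = f a (+) f b.

(* Every closed walk in [U] has even [lam]-sum. *)
Definition even (U : T -> Prop) := exists f, potential U f.

Lemma potential_sub (U W : T -> Prop) f : (forall z, U z -> W z) -> potential W f -> potential U f.
Proof. by move=> UW Wf a b /UW Wa /UW; apply: Wf. Qed.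

Lemma even_sub (U W : T -> Prop) : (forall z, U z -> W z) -> even W -> even U.
Proof. by move=> UW [f Wf]; exists f; apply: potential_sub Wf. Qed.

Lemma potential_reach U f g a b :
  potential U f -> potential U g -> reach nb U a b -> f a (+) f b = g a (+) g b.
Proof.
move=> Uf Ug; elim=> [|b' c ab' eqab bc Uc]; first by rewrite !addbb.
have [_ Ub'] := reach_in ab'.
have := Uf _ _ Ub' Uc bc; rewrite (Ug _ _ Ub' Uc bc).
by move: eqab; case: (f a) (f b') (f c) (g a) (g b') (g c) => [] [] [] [] [] [].
Qed.

Lemma potential_pin U z : even U -> exists2 f, potential U f & f z = false.
Proof.
move=> [f Uf]; exists (fun y => f y (+) f z); last by rewrite addbb.
by move=> a b Ua Ub ab; rewrite (Uf _ _ Ua Ub ab); case: (f a) (f b) (f z) => [] [] [].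
Qed.

(** Potentials normalized to vanish at the common point [z] are unique on each connected [P k], so
    those of the pairwise unions agree. Any adjacency between [P k] and [P l] already lies in one
    such union. *)
Lemma even_star (K : Type) (P : K -> T -> Prop) z :
  (forall k, P k z) -> (forall k, joined nb (P k)) ->
  (forall k l, even (fun y => P k y \/ P l y)) ->
  even (fun y => exists k, P k y).
Proof.
move=> Pz jP evP.
pose ok k g := potential (P k) g /\ g z = false.
pose f y := `[< exists k g, [/\ P k y, ok k g & g y] >].
have uniq k g g' y : P k y -> ok k g -> ok k g' -> g y = g' y.
  move=> Py [Pg gz] [Pg' gz'].
  by have := potential_reach Pg Pg' (jP k _ _ (Pz k) Py); rewrite gz gz'.
have fE k l g y : potential (fun y => P k y \/ P l y) g -> g z = false -> P k y -> f y = g y.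
  move=> Pg gz Pky; rewrite /f; case gy: (g y).
    by apply/asboolP; exists k, g; split=> //; split=> //; apply: potential_sub Pg; left.
  apply/asboolP => -[k' [g' [Pk'y okg' g'y]]].
  have [h Ph hz] := potential_pin z (evP k k').
  have hk : ok k h by split=> //; apply: potential_sub Ph; left.
  have hk' : ok k' h by split=> //; apply: potential_sub Ph; right.
  have gk : ok k g by split=> //; apply: potential_sub Pg; left.
  by move: g'y; rewrite (uniq _ _ _ _ Pk'y okg' hk') -(uniq _ _ _ _ Pky gk hk) gy.
exists f => a b [k Pka] [l Plb] ab.
have [g Pg gz] := potential_pin z (evP k l).
have Pg' : potential (fun y => P l y \/ P k y) g by apply: potential_sub Pg => y [] ?; [right|left].
by rewrite (fE k l g a) // (fE l k g b) //; apply: Pg ab; [left|right].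
Qed.

(** Pieces that do not touch are also disjoint, by reflexivity of [nb], so their potentials combine
    without any compatibility condition. *)
Lemma even_glue (K : Type) (U : K -> T -> Prop) :
  (forall k, even (U k)) ->
  (forall k l a b, U k a -> U l b -> nb a b -> k = l) ->
  even (fun y => exists k, U k y).
Proof.
move=> /choice[F FP] sep.
pose f y := `[< exists2 k, U k y & F k y >].
have fE k y : U k y -> f y = F k y.
  move=> Uy; rewrite /f; case Fy: (F k y); first by apply/asboolP; exists k.
  apply/asboolP => -[l Ul]; rewrite -(sep _ _ _ _ Uy Ul (nb_refl y)) Fy //.
exists f => a b [k Uka] [l Ulb] ab; have kl := sep _ _ _ _ Uka Ulb ab; subst l.
by rewrite (fE _ _ Uka) (fE _ _ Ulb); apply: FP.
Qed.

End Parity.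

(** * Rounding on an abstract cell space *)

Lemma card_lt_inj (D x : nat) (P : pred 'I_D) (f : 'I_D -> nat) :
  {in P &, injective f} -> (forall a, P a -> f a < x) -> #|P| <= x.
Proof.
move=> f_inj f_lt; rewrite cardE -(size_map f) -[x in _ <= x](size_iota 0).
apply: uniq_leq_size.
  by rewrite map_inj_in_uniq ?enum_uniq // => a b; rewrite !mem_enum; apply: f_inj.
by move=> y /mapP[a]; rewrite mem_enum => /f_lt fa ->; rewrite mem_iota.
Qed.

(** Averaging: each [i] is cut by at most [X i] of the [D] offsets, so some offset cuts at most the
    average number. *)
Lemma cheap_offset (I : finType) (X : I -> nat) (D : nat) (cut : I -> pred 'I_D) :
  0 < D -> (forall i, #|cut i| <= X i) ->
  exists a : 'I_D, D * #|[set i | cut i a]| <= \sum_i X i.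
Proof.
move=> D0 cutX; apply/existsP; apply: contraT; rewrite negb_exists => /forallP big.
have: \sum_i X i < \sum_i X i; last by rewrite ltnn.
have sumE : \sum_(a < D) #|[set i | cut i a]| <= \sum_i X i.
  rewrite (eq_bigr (fun a : 'I_D => \sum_(i | cut i a) 1)); last first.
    by move=> a _; rewrite sum1dep_card.
  rewrite (exchange_big_dep predT) //=; apply: leq_sum => i _.
  by rewrite sum1_card.
have: \sum_(a < D) (\sum_i X i).+1 <= \sum_(a < D) D * #|[set i | cut i a]|.
  by apply: leq_sum => a _; rewrite ltnNge.
rewrite sum_nat_const card_ord -big_distrr leq_mul2l /= => /orP[|]; first by lia.
by move=> h; apply: leq_trans sumE.
Qed.

Lemma sum_mem_seq (I : finType) (X : I -> nat) (l : seq I) :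
  \sum_(i in [set i in l]) X i <= \sum_(i <- l) X i.
Proof.
elim: l => [|x l IHl]; first by rewrite big1 // => i; rewrite !inE.
rewrite big_cons; apply: leq_trans (leq_add (leqnn _) IHl).
rewrite (bigID (pred1 x)) /= leq_add //.
  rewrite (big_pred1 x) // => i.
  by rewrite !inE /=; case: (i == x); rewrite ?andbT ?andbF.
rewrite big_mkcond [leqRHS]big_mkcond /=; apply: leq_sum => i _.
by rewrite !inE; case: (i == x) (i \in l) => [] [].
Qed.

Section Rounding.
Variables (T : Type) (nb : T -> T -> Prop) (lam : T -> T -> bool).
Hypothesis nb_refl : forall a, nb a a.
Hypothesis nb_sym : forall a b, nb a b -> nb b a.
Variables (I : finType) (reg : I -> T -> Prop) (X : I -> nat) (D : nat).
Hypothesis D_gt0 : 0 < D.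
Hypothesis reg_joined : forall i, joined nb (reg i).
Hypothesis X_lt : forall i, X i < D.
Variables (s t : T) (q : nat -> T) (L : nat).
Hypothesis q0 : q 0 = s.
Hypothesis qL : q L = t.
Hypothesis q_nb : forall k, nb (q k) (q k.+1).
Hypothesis even_path : forall U : T -> Prop, reach nb (fun z => ~ U z) s t -> even nb lam U.
Hypothesis even_light : forall S : {set I}, \sum_(i in S) X i < 9 * D ->
  even nb lam (fun z => exists2 i, i \in S & reg i z).

Let H : rel I := fun i j => `[< exists a b, [/\ reg i a, reg j b & nb a b] >].

Let H_sym : symmetric H.
Proof. by move=> i j; apply/asboolP/asboolP => -[a [b [? ? /nb_sym ?]]]; exists b, a. Qed.

Let H_meet i j z : reg i z -> reg j z -> H i j.
Proof. by move=> iz jz; apply/asboolP; exists z, z. Qed.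

Lemma chain_joined i p :
  path H i p -> joined nb (fun z => exists2 j, j \in i :: p & reg j z).
Proof.
elim: p i => [|j p IHp] i /=.
  move=> _ a b [k]; rewrite inE => /eqP -> ia [l]; rewrite inE => /eqP -> ib.
  by apply: reach_mono (reg_joined ia ib) => z iz; exists i; rewrite ?inE.
case/andP=> /asboolP[a [b [ia jb ab]]] /IHp jP.
have jb' : exists2 k, k \in j :: p & reg k b by exists j; rewrite ?inE ?eqxx.
have jU := joined_or nb_sym (reg_joined (i := i)) jP ia jb' ab.
move=> x y [k kin kx] [l lin ly].
have inU k' z : k' \in [:: i, j & p] -> reg k' z ->
    reg i z \/ exists2 k, k \in j :: p & reg k z.
  by rewrite inE => /orP[/eqP -> | kin'] kz; [left | right; exists k'].
apply: reach_mono (jU _ _ (inU _ _ kin kx) (inU _ _ lin ly)) => z [iz | [k' kin' kz]].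
  by exists i; rewrite ?inE ?eqxx.
by exists k' => //; rewrite inE kin' orbT.
Qed.

Section FirstRoots.
Variables (R : rel I) (R_sym : symmetric R) (g : nat -> T).

Definition meets i := exists k j, [/\ k <= L, connect R i j & reg j (g k)].

(** A representative chosen at [fingraph.root R i] is constant on classes; if the class meets the
    curve [g], one that contains its earliest point on [g] is taken. The last visit of [q] is
    obtained from the reversed curve. *)
Lemma first_roots : exists rho : I -> I,
  [/\ forall i, connect R (rho i) i, forall i j, R i j -> rho i = rho j
    & forall i, meets i -> exists k, [/\ k <= L, reg (rho i) (g k)
        & forall k' j, k' <= L -> connect R i j -> reg j (g k') -> k <= k'] ].
Proof.
have csym : connect_sym R by apply: sym_connect_sym.
pose good i j := connect R i j /\ (meets i -> exists k, [/\ k <= L, reg j (g k)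
        & forall k' j', k' <= L -> connect R i j' -> reg j' (g k') -> k <= k']).
have ex i : exists j, good i j.
  have [[k [j [kL ij jk]]]|nm] := pselect (meets i); last by exists i; split.
  pose P k := `[< exists j, [/\ k <= L, connect R i j & reg j (g k)] >].
  have exP : exists k, P k by exists k; apply/asboolP; exists j.
  case: (ex_minnP exP) => m /asboolP[j' [mL ij' jm]] mmin; exists j'; split=> // _.
  exists m; split=> // k' j'' k'L ij'' jk'.
  by apply: mmin; apply/asboolP; exists j''.
have [r rP] := choice ex; exists (fun i => r (fingraph.root R i)); split.
- by move=> i; have [h _] := rP (fingraph.root R i); rewrite csym (connect_trans (connect_root _ _) h).
- by move=> i j Rij; congr r; apply/eqP; rewrite (root_connect csym); apply: connect1.
move=> i [k [j [kL ij jk]]]; have [_ h] := rP (fingraph.root R i).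
have ri j' : connect R (fingraph.root R i) j' = connect R i j'.
  by rewrite -(same_connect csym (connect_root R i)).
case: h; first by exists k, j; rewrite ri.
move=> m [mL rm mmin]; exists m; split=> // k' j' k'L ij'; apply: mmin => //.
by rewrite ri.
Qed.

End FirstRoots.

(** The factor 2 pays for the two chops. A region is cut when a chop value falls into the stretch of
    length [X i] ending at its distance, so regions of weight zero are never deleted. *)
Lemma rounding : exists F : {set I},
  [/\ D * #|F| <= 2 * \sum_i X i, forall i, i \in F -> 0 < X i
    & even nb lam (fun z => exists2 i, i \notin F & reg i z)].
Proof.
(* Distances [d1] are measured from the last region of the class met by the path [q]. *)
have [rho1 [rho1_conn rho1_eq rho1_q]] := first_roots H_sym (fun k => q (L - k)).
have [d1 [_ d1_step d1_path]] := root_distance X rho1_conn rho1_eq.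
pose slab a i := (d1 i + a) %/ D.
pose cut1 i (a : 'I_D) := (d1 i - X i + a) %/ D != slab a i.
have [a cut1_le] : exists a : 'I_D, D * #|[set i | cut1 i a]| <= \sum_i X i.
  apply: cheap_offset => // i.
  (* The offset [a] cuts [i] only if the residue of [d1 i + a] is below [X i], and distinct offsets
     have distinct residues. *)
  apply: (@card_lt_inj D (X i) (cut1 i) (fun a => (d1 i + a) %% D)).
    move=> a b _ _ /eqP; rewrite eqn_modDl !modn_small // => /eqP; exact: val_inj.
  move=> a; rewrite /cut1 /slab => /negP ncut; rewrite ltnNge; apply/negP => le; apply: ncut.
  have Xi := X_lt i.
  have [lt|ge] := leqP (X i) (d1 i); last first.
    have := leq_trans le (leq_mod (d1 i + a) D) => le'.
    rewrite eqn_leq leq_div2r ?leq_add2r ?leq_subr //=.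
    have ->: d1 i - X i = 0 by lia.
    have ad := ltn_ord a.
    rewrite add0n [a %/ D]divn_small // leqn0 -leqn0 -ltnS ltn_divLR // mul1n.
    rewrite ltnNge; apply/negP => dge.
    have: (d1 i + a) %% D <= d1 i + a - D.
      by rewrite -{1}(subnK dge) modnDr leq_mod.
    lia.
  have := divn_eq (d1 i + a) D; set m := _ %/ _ => e.
  have -> : d1 i - X i + a = m * D + ((d1 i + a) %% D - X i) by lia.
  rewrite divnMDl // divn_small ?addn0 //.
  by apply: leq_ltn_trans (leq_subr _ _) (ltn_pmod _ _).
pose R2 i j := H i j && (slab a i == slab a j).
have R2_sym : symmetric R2 by move=> i j; rewrite /R2 H_sym eq_sym.
have [rho2 [rho2_conn rho2_eq rho2_q]] := first_roots R2_sym q.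
have [d2 [d2_root d2_step d2_path]] := root_distance X rho2_conn rho2_eq.
(* A region meeting the chain used in the far case has distance below [3 * D]: one [D] for the width
   of the slab and one for each of two light regions. Two chains within the threshold weigh less
   than [8 * D], which [even_light] tolerates. *)
pose cut2 i (r : 'I_D) := d2 i - X i <= 3 * D + r < d2 i.
have [r cut2_le] : exists r : 'I_D, D * #|[set i | cut2 i r]| <= \sum_i X i.
  apply: cheap_offset => // i.
  apply: (@card_lt_inj D (X i) (cut2 i) (fun r => (d2 i).-1 - (3 * D + r))).
    by move=> r r'; rewrite !unfold_in /cut2 => ? ? ?; apply: val_inj => /=; lia.
  by move=> r; rewrite /cut2; lia.
pose F := [set i | cut1 i a] :|: [set i | cut2 i r].
have slab_conn i j : connect R2 i j -> slab a i = slab a j.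
  case/connectP=> p; elim: p i => [|k p IHp] i /=; first by move=> _ ->.
  by case/andP=> /andP[_ /eqP ->]; apply: IHp.
have connH i j : connect R2 i j -> connect H i j.
  by apply: connect_sub => k l /andP[kl _]; apply: connect1.
have rho2_class i j : connect R2 i j -> rho2 i = rho2 j.
  case/connectP=> p; elim: p i => [|k p IHp] i /=; first by move=> _ ->.
  by case/andP=> /rho2_eq ->; apply: IHp.
(* The stretch of an uncut [i] starts in its own slab, and a touching [j] has distance at least
   [d1 i - X i]. Two survivors that touch therefore share a slab. *)
have H_slab i j : i \notin F -> H i j -> slab a i <= slab a j.
  move=> + Hij; rewrite !inE negb_or => /andP[]; rewrite negbK => /eqP <- _.
  have /d1_step dij : H j i by rewrite H_sym.
  by apply: leq_div2r; lia.
(* Survivors are grouped by component of their slab and by side of the second threshold; groups with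
   different keys do not touch. *)
pose key i := (rho2 i, d2 i <= 3 * D + r).
pose U k z := exists i, [/\ i \notin F, key i = k & reg i z].
exists F; split.
- have := cardsU [set i | cut1 i a] [set i | cut2 i r]; rewrite -/F; nia.
- by move=> i; rewrite !inE /cut1 /cut2; case: (X i) => // /orP[]; rewrite subn0 ?eqxx //; lia.
suff: even nb lam (fun z => exists k, U k z).
  by apply: even_sub => z [i iF iz]; exists (key i), i.
apply: even_glue => //; last first.
  move=> k l x y [i [iF <- ix]] [j [jF <- jy]] xy.
  have Hij : H i j by apply/asboolP; exists x, y.
  have R2ij : R2 i j.
    by rewrite /R2 Hij eqn_leq !H_slab // H_sym.
  have half i' j' : R2 i' j' -> j' \notin F -> d2 i' <= 3 * D + r -> d2 j' <= 3 * D + r.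
    by move=> /d2_step d2ij; rewrite !inE negb_or /cut2 => /andP[_]; lia.
  congr pair; first exact: rho2_eq.
  by apply/idP/idP; apply: half; rewrite // R2_sym.
case=> rho b; have [[z0 Uz0]|empty] := pselect (exists z, U (rho, b) z); last first.
  by exists (fun=> false) => x y Ux; case: empty; exists x.
case: Uz0 => i0 [i0F [rho_i0 bE] i0z].
have rho_conn0 : connect R2 rho i0 by rewrite -rho_i0.
have rho_rho : rho2 rho = rho by rewrite (rho2_class _ _ rho_conn0).
have path_H i p : path R2 i p -> path H i p.
  by apply: sub_path => k l /andP[].
case: b bE => bE.
  (* The ball around [rho]: chains from [rho] have weight at most [4 D]. *)
  have [z1 rz1] : exists z, reg rho z.
    case/connectP: rho_conn0 => -[|j p] /=; first by move=> _ <-; exists z0.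
    by case/andP=> /andP[/asboolP[x [y [rx _ _]]] _] _ _; exists x.
  have [P PP] := choice d2_path.
  pose K := {i | rho2 i = rho /\ d2 i <= 3 * D + r}.
  pose ch (k : K) := rho :: P (sval k).
  have chP (k : K) : [/\ path R2 rho (P (sval k)), last rho (P (sval k)) = sval k
      & cost X (ch k) <= 3 * D + r].
    case: k => i [ri di]; have [pP lp cp] := PP i.
    rewrite /ch /= -ri; split=> //.
    by rewrite (cp (P i) [::]) ?cats0 // lp.
  have: even nb lam (fun z => exists k : K, exists2 j, j \in ch k & reg j z).
    apply: (even_star (z := z1)).
    - by move=> k; exists rho; rewrite ?inE ?eqxx.
    - by move=> k; have [pP _ _] := chP k; apply: chain_joined; apply: path_H.
    move=> k l.
    have: even nb lam (fun z => exists2 i, i \in [set i in ch k ++ ch l] & reg i z).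
      apply: even_light; apply: leq_ltn_trans (sum_mem_seq _ _) _.
      rewrite -/(cost X _) cost_cat.
      have [_ _ ck] := chP k; have [_ _ cl] := chP l; have := ltn_ord r; lia.
    apply: even_sub => z [[j jk jz]|[j jl jz]]; exists j => //;
      by rewrite inE mem_cat ?jk ?jl ?orbT.
  apply: even_sub => z [i [iF [ri di] iz]].
  exists (exist _ i (conj ri di)); exists i => //=.
  have [_ lp _] := chP (exist _ i (conj ri di)); rewrite /= in lp.
  by rewrite /ch /= -[X in X \in _]lp mem_last.
(* Outside the ball: the path [q] up to its first visit of [rho], then the shortest
   chain to the last region of the class, then [q] again. *)
apply: even_path; rewrite -q0 -qL.
have [rho_meets|no_meet] := pselect (meets R2 q rho); last first.
  apply: reach_fun => // k kL [i [_ [ri _] iz]].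
  by apply: no_meet; exists k, i; split=> //; rewrite -ri.
have [k1 []] := rho2_q _ rho_meets; rewrite rho_rho => k1L rk1 k1min.
have [k2 [k2L ck2 k2min]] : exists k, [/\ k <= L, reg (rho1 rho) (q (L - k)) &
    forall k' j, k' <= L -> connect H rho j -> reg j (q (L - k')) -> k <= k'].
  apply: rho1_q; exists (L - k1), rho; split=> //; first exact: leq_subr.
  by rewrite subKn.
have U_conn i : key i = (rho, false) -> connect R2 rho i by case=> <- _.
have [p [pP lp cp]] := d1_path rho.
(* Suppose a far survivor [i] meets the chain at [j]. Then [j] lies in the slab of [rho], and so
   does the rest of the chain, along which [d1] stays between [d1 j] and [d1 rho]. Walking it
   backwards from [rho] bounds [d2 i] by less than [3 * D], a contradiction. *)
have chain_avoids z : (exists2 j : I, j \in rho1 rho :: p & reg j z) -> ~ U (rho, false) z.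
  case=> j jp jz [i [iF ki iz]].
  have [p1 [p2 [def_p lp1]]] : exists p1 p2 : seq I, p = p1 ++ p2 /\ last (rho1 rho) p1 = j.
    by case: (splitPl jp) => p1 p2 lp1; exists p1, p2.
  move: pP lp cp; rewrite def_p cat_path last_cat lp1 => /andP[_ p2P] lp2 cp.
  have cj : cost X (rho1 rho :: p1) = d1 j by rewrite (cp p1 p2) // lp1.
  have cr : d1 j + cost X p2 = d1 rho.
    rewrite -cj -cost_cat cat_cons (cp (p1 ++ p2) [::]) ?cats0 //.
    by rewrite last_cat lp1 lp2.
  have slab_j : slab a j = slab a rho.
    apply/eqP; rewrite eqn_leq; apply/andP; split; first by apply: leq_div2r; lia.
    by rewrite (slab_conn _ _ (U_conn _ ki)) H_slab // (H_meet iz jz).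
  have p2R : path R2 j p2.
    have: forall p3 p4, p2 = p3 ++ p4 -> slab a (last j p3) = slab a j.
      move=> p3 p4 def_p2; have cl : d1 j + cost X p3 = d1 (last j p3).
        rewrite -cj -cost_cat cat_cons (cp (p1 ++ p3) p4) ?last_cat ?lp1 //.
        by rewrite def_p2 catA.
      have cle : cost X p3 <= cost X p2 by rewrite def_p2 cost_cat leq_addr.
      apply/eqP; rewrite eqn_leq {1}slab_j; apply/andP; split; apply: leq_div2r; lia.
    elim: (p2) (j) p2P => //= l p' IHp i' /andP[Hil lP] sl.
    have sl1 := sl [:: l] p' erefl; rewrite /= in sl1.
    by rewrite /R2 Hil sl1 eqxx; apply: IHp => // p3 p4 e; rewrite sl1 -(sl (l :: p3) p4) ?e.
  have d2j : d2 j <= d2 rho + cost X (belast j p2).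
    rewrite -lp2; elim: (p2) (j) p2R => [|l p' IHp] i' /=; first by rewrite leq_addr.
    case/andP; rewrite R2_sym => /d2_step d2l /IHp IH.
    by rewrite cost_cons; lia.
  have cb : cost X (belast j p2) + X rho = X j + cost X p2.
    by rewrite -cost_cons lastI -cats1 cost_cat cost_cons /cost big_nil addn0 lp2.
  have := d2_root _ rho_rho.
  have rlt : d1 rho - d1 j < D.
    move: slab_j; rewrite /slab => e.
    have := divn_eq (d1 j + a) D; have := divn_eq (d1 rho + a) D.
    have := ltn_pmod (d1 j + a) D_gt0; have := ltn_pmod (d1 rho + a) D_gt0; rewrite e; lia.
  have R2ij : R2 j i.
    by rewrite /R2 (H_meet jz iz) slab_j (slab_conn _ _ (U_conn _ ki)) eqxx.
  have := d2_step _ _ R2ij; case: ki => _ /negbT.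
  have := X_lt j; have := X_lt i; lia.
have in_chain1 : exists2 j, j \in rho1 rho :: p & reg j (q k1).
  by exists rho => //; rewrite -[X in X \in _]lp mem_last.
have in_chain2 : exists2 j, j \in rho1 rho :: p & reg j (q (L - k2)).
  by exists (rho1 rho) => //; rewrite inE eqxx.
apply: (@reach_trans _ _ _ _ (q k1)).
  apply: reach_fun => // k /andP[_]; rewrite leq_eqVlt => /orP[/eqP ->|kk1].
    exact: chain_avoids.
  move=> [i [iF ki iz]]; have := k1min k i _ (U_conn _ ki) iz; lia.
apply: (@reach_trans _ _ _ _ (q (L - k2))).
  exact: reach_mono chain_avoids (chain_joined pP in_chain1 in_chain2).
apply: reach_fun => // [|k /andP[]]; first exact: leq_subr.
rewrite leq_eqVlt => /orP[/eqP <- _|k2k kL]; first exact: chain_avoids.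
move=> [i [iF ki iz]].
have := k2min (L - k) i (leq_subr _ _) (connH _ _ (U_conn _ ki)).
rewrite subKn // => /(_ iz); lia.
Qed.

End Rounding.

(** * The triangular lattice *)

Notation cell := (nat * nat)%type.

Definition up (a b : cell) :=
  [|| (b.1 == a.1.+1) && (b.2 == a.2), (b.1 == a.1) && (b.2 == a.2.+1)
    | (b.1 == a.1.+1) && (b.2 == a.2.+1)].

(* Equality or adjacency in the triangulated square lattice, where the boundary of a connected
   set of cells is connected for the same adjacency. *)
Definition nb (a b : cell) := [|| a == b, up a b | up b a].

(* [lam1 v] detects the edges crossing the vertical ray below [v]; summed over a closed walk
   avoiding [v] it gives the parity of the winding number around [v]. *)
Definition ray (v a b : cell) := [&& a.1 == v.1, a.2 < v.2 & b.1 == v.1.+1].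
Definition lam1 (v a b : cell) := ray v a b (+) ray v b a.

Ltac split_atoms := rewrite ?eqSS ?ltnS; repeat match goal with
 | |- context [@eq_op _ ?x ?y] => case: (@eqP _ x y) => ?; try (exfalso; lia)
 | |- context [leq ?x ?y] => case: (@ssrnat.leP x y) => ?; try (exfalso; lia)
 end.

Lemma lam1C v a b : lam1 v a b = lam1 v b a.
Proof. by rewrite /lam1 addbC. Qed.

Lemma nb_refl a : nb a a.
Proof. by rewrite /nb eqxx. Qed.

Lemma nb_sym a b : nb a b -> nb b a.
Proof. by rewrite /nb eq_sym => /or3P[] ->; rewrite ?orbT. Qed.

(** If [w] lies in the next column, the edges crossing exactly one of the two rays are those leaving
    the set of cells of that column below [w], whose indicator is [g]. If [w] is directly above [v],
    the rays differ only in edges at [v], which are excluded, and [g] vanishes. *)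
Lemma lam1_up v w : up v w -> exists g : cell -> bool, forall a b, up a b ->
  a != v -> a != w -> b != v -> b != w -> lam1 v a b (+) lam1 w a b = g a (+) g b.
Proof.
case: v w => [v1 v2] [w1 w2] vw.
exists (fun z => [&& z.1 == v1.+1, z.2 < w2 & w1 == v1.+1]) => -[a1 a2] [b1 b2].
move: vw; rewrite /lam1 /ray /up !xpair_eqE /=.
move=> /or3P[] /andP[/eqP -> /eqP ->] /or3P[] /andP[/eqP -> /eqP ->].
all: split_atoms; by [].
Qed.

Lemma lam1_nb v w : nb v w -> exists g : cell -> bool, forall a b, nb a b ->
  a != v -> a != w -> b != v -> b != w -> lam1 v a b (+) lam1 w a b = g a (+) g b.
Proof.
have up_nb v' w' : up v' w' -> exists g : cell -> bool, forall a b, nb a b ->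
    a != v' -> a != w' -> b != v' -> b != w' -> lam1 v' a b (+) lam1 w' a b = g a (+) g b.
  case/lam1_up=> g gP; exists g => a b /or3P[/eqP -> *|/gP|/gP gba av aw bv bw] //.
    by rewrite /lam1 !addbb.
  by rewrite [g a (+) _]addbC -gba // (lam1C v') (lam1C w').
case/or3P=> [/eqP <-|/up_nb //|/up_nb[g gP]].
  by exists (fun=> false) => a b *; rewrite addbb.
by exists g => a b ab av aw bv bw; rewrite addbC gP.
Qed.

(** A closed walk avoiding [s] and [t] has odd sum when its winding numbers around [s] and [t]
    differ in parity, and then it separates them. *)
Definition lam (s t a b : cell) := lam1 s a b (+) lam1 t a b.

(* The ray cocycle at [s] is moved to [t] along the path; each step changes it by a coboundary. *)
Lemma even_of_path s t (U : cell -> Prop) : reach nb (fun z => ~ U z) s t -> even nb (lam s t) U.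
Proof.
elim=> [|b c sb [g gP] bc Uc].
  by exists (fun=> false) => a b *; rewrite /lam addbb.
have [_ Ub] := reach_in sb; have [h hP] := lam1_nb bc.
exists (fun z => g z (+) h z) => x y Ux Uy xy.
have neq z w : U z -> ~ U w -> z != w by move=> Uz Uw; apply/eqP => zw; apply: Uw; rewrite -zw.
have := gP x y Ux Uy xy; have := hP x y xy (neq _ _ Ux Ub) (neq _ _ Ux Uc) (neq _ _ Uy Ub) (neq _ _ Uy Uc).
by rewrite /lam; case: (lam1 b x y) (lam1 c x y) (lam1 s x y) (g x) (g y) (h x) (h y) => [] [] [] [] [] [] [].
Qed.

Lemma sum_telescope (h : nat -> bool) N :
  \big[addb/false]_(j < N) (h j (+) h j.+1) = h 0 (+) h N.
Proof.
elim: N => [|N IHN]; first by rewrite big_ord0 addbb.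
by rewrite big_ord_recr IHN /= addbA -[_ (+) h N (+) h N]addbA addbb addbF.
Qed.

(** Stokes modulo 2: a diagonal cancels within its square, horizontal edges telescope along columns
    and vertical ones along rows, leaving only the boundary of the box, where [mu] vanishes. *)
Lemma triangle_sum (mu : cell -> cell -> bool) N :
  (forall i, ~~ mu (i, 0) (i.+1, 0)) -> (forall i, ~~ mu (i, N) (i.+1, N)) ->
  (forall j, ~~ mu (0, j) (0, j.+1)) -> (forall j, ~~ mu (N, j) (N, j.+1)) ->
  \big[addb/false]_(i < N) \big[addb/false]_(j < N)
    (mu (i : nat, j : nat) (i.+1, j : nat) (+) mu (i.+1, j : nat) (i.+1, j.+1) (+)
       mu (i : nat, j : nat) (i.+1, j.+1) (+)
     (mu (i : nat, j : nat) (i : nat, j.+1) (+) mu (i : nat, j.+1) (i.+1, j.+1) (+)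
       mu (i : nat, j : nat) (i.+1, j.+1))) = false.
Proof.
move=> h0 hN v0 vN.
pose h i j := mu (i, j) (i.+1, j); pose v i j := mu (i, j) (i, j.+1).
rewrite (eq_bigr (fun i : 'I_N => \big[addb/false]_(j < N) (v i j (+) v i.+1 j))); last first.
  move=> i _; rewrite (eq_bigr (fun j : 'I_N => (h i j (+) h i j.+1) (+) (v i j (+) v i.+1 j))).
    by rewrite big_split sum_telescope /= /h (negbTE (h0 i)) (negbTE (hN i)).
  move=> j _; rewrite /h /v.
  by move: (mu _ _) (mu _ _) (mu _ _) (mu _ _) (mu _ _) => [] [] [] [] [].
rewrite exchange_big big1 // => j _.
by rewrite (sum_telescope (fun i => v i j)) /v (negbTE (v0 j)) (negbTE (vN j)).
Qed.

Lemma sum_indicator N (F : nat -> nat -> bool) i0 j0 : i0 < N -> j0 < N -> F i0 j0 ->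
  (forall i j, F i j -> i = i0 /\ j = j0) ->
  \big[addb/false]_(i < N) \big[addb/false]_(j < N) F i j = true.
Proof.
move=> i0N j0N F0 Funiq.
rewrite (bigD1 (Ordinal i0N)) //= (bigD1 (Ordinal j0N)) //= F0 !big1 ?addbF //.
  move=> i ne; rewrite big1 // => j _; apply/negP => /Funiq[e _].
  by move/eqP: ne; apply; apply: val_inj.
by move=> j ne; apply/negP => /Funiq[_ e]; move/eqP: ne; apply; apply: val_inj.
Qed.

Lemma lam1_lower v i j :
  lam1 v (i, j) (i.+1, j) (+) lam1 v (i.+1, j) (i.+1, j.+1) (+) lam1 v (i, j) (i.+1, j.+1) = false.
Proof. by case: v => v1 v2; rewrite /lam1 /ray /=; split_atoms. Qed.

(** The ray crosses two edges or none of each triangle, except in the upper triangle with upper left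
    corner [v], where it begins. *)
Lemma lam1_upper v i j :
  lam1 v (i, j) (i, j.+1) (+) lam1 v (i, j.+1) (i.+1, j.+1) (+) lam1 v (i, j) (i.+1, j.+1)
  = (i == v.1) && (j.+1 == v.2).
Proof. by case: v => v1 v2; rewrite /lam1 /ray /=; split_atoms. Qed.

Lemma lam_lower s t i j :
  lam s t (i, j) (i.+1, j) (+) lam s t (i.+1, j) (i.+1, j.+1) (+) lam s t (i, j) (i.+1, j.+1) = false.
Proof.
rewrite /lam; have := lam1_lower s i j; have := lam1_lower t i j.
by do 6!case: (lam1 _ _ _).
Qed.

Lemma lam_upper s t i j :
  lam s t (i, j) (i, j.+1) (+) lam s t (i, j.+1) (i.+1, j.+1) (+) lam s t (i, j) (i.+1, j.+1)
  = ((i == s.1) && (j.+1 == s.2)) (+) ((i == t.1) && (j.+1 == t.2)).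
Proof. by rewrite /lam -!lam1_upper; do 6!case: (lam1 _ _ _). Qed.

(* The potential [f] makes [lam] vanish on the boundary of [R], so that [lam], restricted to the
   edges touching [R], becomes a finitely supported cochain with a single odd triangle, at [s]. *)
Lemma not_even_boundary s t (U : cell -> Prop) (R : cell -> bool) N :
  even nb (lam s t) U -> R s ->
  (forall a b, R a -> nb a b -> R b \/ U b) ->
  (forall z, R z -> [/\ 0 < z.1 < N & 0 < z.2 < N]) ->
  (forall z, nb z t -> ~~ R z) -> False.
Proof.
move=> [f Uf] Rs Rcl Rbox Rt.
pose m a b := lam s t a b (+) f a (+) f b.
pose mu a b := (R a || R b) && m a b.
have mU a b : U a -> U b -> nb a b -> m a b = false.
  by move=> Ua Ub ab; rewrite /m (Uf _ _ Ua Ub ab); case: (f a) (f b) => [] [].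
(* In a triangle with a corner in [R], an edge without an end in [R] joins two cells of [U], where
   [m] vanishes; hence [mu] and [m] have the same sum there. *)
have tri a b c : nb a b -> nb b c -> nb a c ->
    mu a b (+) mu b c (+) mu a c =
    [|| R a, R b | R c] && (lam s t a b (+) lam s t b c (+) lam s t a c).
  move=> ab bc ac; have ba := nb_sym ab; have cb := nb_sym bc; have ca := nb_sym ac.
  have -> : lam s t a b (+) lam s t b c (+) lam s t a c = m a b (+) m b c (+) m a c.
    by rewrite /m; move: (lam _ _ _ _) (lam _ _ _ _) (lam _ _ _ _) (f a) (f b) (f c) => [] [] [] [] [] [].
  have Ubc : R a -> ~~ R b -> ~~ R c -> m b c = false.
    move=> Ra /negP nRb /negP nRc; have [//|Ub] := Rcl _ _ Ra ab.
    by have [//|Uc] := Rcl _ _ Ra ac; apply: mU.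
  have Uac : R b -> ~~ R a -> ~~ R c -> m a c = false.
    move=> Rb /negP nRa /negP nRc; have [//|Ua] := Rcl _ _ Rb ba.
    by have [//|Uc] := Rcl _ _ Rb bc; apply: mU.
  have Uab : R c -> ~~ R a -> ~~ R b -> m a b = false.
    move=> Rc /negP nRa /negP nRb; have [//|Ua] := Rcl _ _ Rc ca.
    by have [//|Ub] := Rcl _ _ Rc cb; apply: mU.
  move: Ubc Uac Uab; rewrite /mu; case: (R a) (R b) (R c) => [] [] [] //= Ubc Uac Uab;
    by rewrite ?addbF //;
      [> try rewrite (Ubc isT isT isT); try rewrite (Uac isT isT isT); try rewrite (Uab isT isT isT) | ..]; rewrite ?addbF.
have nR z : ~~ ((0 < z.1 < N) && (0 < z.2 < N)) -> R z = false.
  by move=> nz; apply/negP => /Rbox[z1 z2]; case/negP: nz; rewrite z1 z2.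
have /andP[/andP[s1_gt0 s1_lt] /andP[s2_gt0 s2_lt]] : (0 < s.1 < N) && (0 < s.2 < N).
  by have [-> ->] := Rbox _ Rs.
pose F i j := [|| R (i, j), R (i, j.+1) | R (i.+1, j.+1)] && ((i == s.1) && (j.+1 == s.2)).
have mu0 x y : ~~ R x -> ~~ R y -> ~~ mu x y.
  by rewrite /mu => /negbTE nx /negbTE ny; rewrite nx ny.
have := @triangle_sum mu N; rewrite (eq_bigr (fun i : 'I_N => \big[addb/false]_(j < N) F i j)).
  rewrite (@sum_indicator N F s.1 s.2.-1) //; [|lia| |].
  - by move=> h; suff: true = false by []; apply: h => k; apply: mu0; rewrite nR //=; lia.
  - by rewrite /F prednK // !eqxx andbT -surjective_pairing Rs orbT.
  by move=> i j /andP[_ /andP[/eqP -> /eqP <-]].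
move=> i _; apply: eq_bigr => j _.
rewrite !tri; last 1 first.
all: try by rewrite /nb /up /= !eqxx ?orbT.
rewrite lam_lower lam_upper andbF /F /=.
case Rtri: [|| _, _ | _] => //=.
(* The corners of the odd triangle at [t] are all equal or adjacent to [t], so none is in [R]. *)
suff -> : (i == t.1 :> nat) && (j.+1 == t.2) = false by rewrite addbF.
apply/negP => /andP[/eqP it /eqP jt].
have tE : t = (i : nat, j.+1) by rewrite it jt -surjective_pairing.
by move: Rtri; rewrite !(negbTE (Rt _ _)) // tE /nb /up /= !eqxx ?orbT.
Qed.

(** * Contact models on the lattice *)

Lemma reach_seq (T : Type) (nb : T -> T -> Prop) (A : T -> Prop) a b :
  (forall z, nb z z) -> reach nb A a b ->
  exists (q : nat -> T) L, [/\ q 0 = a, q L = b & forall k, nb (q k) (q k.+1)].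
Proof.
move=> nbr; elim=> [_|c d _ [q [L [q0 qL qn]]] cd _]; first by exists (fun=> a), 0.
exists (fun k => if k <= L then q k else d), L.+1; split=> //; first by rewrite ltnn.
move=> k; have [kL|Lk] := leqP k L; last by rewrite ltnNge (ltnW Lk).
by have [//|Lk] := leqP k.+1 L; rewrite -qL in cd; have -> : k = L by lia.
Qed.

(** Otherwise the part of [A] reachable from [s] is bounded, contains no neighbor of [t] and has its
    outer boundary in [U], against [not_even_boundary]. This is the converse direction to
    [even_of_path]. *)
Lemma even_connect s t (A U : cell -> Prop) N :
  even nb (lam s t) U -> A s -> A t ->
  (forall z, A z -> [/\ 0 < z.1 < N & 0 < z.2 < N]) ->
  (forall a b, A a -> nb a b -> A b \/ U b) -> reach nb A s t.
Proof.
move=> evU As At Abox Acl; apply: contrapT => nst.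
apply: (@not_even_boundary s t U (fun z => `[< reach nb A s z >]) N evU).
- by apply/asboolP; apply: reach_refl.
- move=> a b /asboolP sa ab; have [_ Aa] := reach_in sa.
  by case: (Acl _ _ Aa ab) => [Ab|]; [left; apply/asboolP; apply: reach_step ab Ab | right].
- by move=> z /asboolP sz; have [_ /Abox] := reach_in sz.
by move=> z zt; apply/asboolP => sz; apply: nst; apply: reach_step zt At.
Qed.

Section ContactModel.
Variables (V : finType) (e : rel V) (l : cell -> option V) (N : nat).

(** [None] marks the obstacle cells. The strict bounds in [cm_box] leave a frame of obstacles around
    all labelled cells. *)
Record contact_model : Prop := ContactModel {
  cm_cell : forall v, exists z, l z = Some v;
  cm_joined : forall v, joined nb (fun z => l z = Some v);
  cm_edge : forall a b u v, l a = Some u -> l b = Some v -> nb a b -> u != v -> e u v;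
  cm_contact : forall u v, e u v -> u != v -> exists a b, [/\ l a = Some u, l b = Some v & nb a b];
  cm_box : forall z, l z <> None -> [/\ 0 < z.1 < N & 0 < z.2 < N] }.

Hypothesis cm : contact_model.

Lemma lift_connect (W : {set V}) u v a b : u \in W -> connect (induced_rel e W) u v ->
  l a = Some u -> l b = Some v -> reach nb (fun z => exists2 w, w \in W & l z = Some w) a b.
Proof.
move=> uW /connectP[p]; elim: p u a uW => [|w p IHp] u a uW /=.
  move=> _ -> la lb; apply: reach_mono (cm_joined cm la lb) => z lz; by exists u.
case/andP=> /and3P[uw _ wW] pP vE la lb.
have [uw_eq|neq] := eqVneq u w; first by subst w; apply: IHp vE la lb.
have [a' [b' [la' lb' ab']]] := cm_contact cm uw neq.
apply: reach_trans (IHp _ _ wW pP vE lb' lb).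
apply: reach_step ab' _; last by exists w.
by apply: reach_mono (cm_joined cm la la') => z lz; exists u.
Qed.

Lemma drop_reach (W : {set V}) u a b : u \in W -> l a = Some u ->
  reach nb (fun z => exists2 w, w \in W & l z = Some w) a b ->
  exists v, [/\ v \in W, l b = Some v & connect (induced_rel e W) u v].
Proof.
move=> uW la; elim=> [_|b' c _ [v [vW lb uv]] bc [w wW lc]]; first by exists u; rewrite connect0.
exists w; split=> //; have [<- //|neq] := eqVneq v w.
apply: connect_trans uv (connect1 _); rewrite /induced_rel vW wW !andbT.
exact: cm_edge cm _ _ _ _ lb lc bc neq.
Qed.

Variables (m : nat) (sigma : V -> {set 'I_m}) (s t : V).
Hypothesis colors_connected : color_connected e sigma.
Hypothesis st_connected : connect e s t.

Lemma separator_end v c : (v == s) || (v == t) -> c \in sigma v -> is_separator e sigma s t [set c].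
Proof.
move=> vst cv; have vC : v \in Vcol sigma [set c].
  by rewrite inE disjoint_sym disjoints1 cv.
rewrite /is_separator; apply/negP => /andP[sC /connectP[p]].
case: (lastP p) => [_ ts|p' w]; first by move: vst vC; rewrite ts orbb => /eqP ->; rewrite (negbTE sC).
rewrite rcons_path last_rcons => /andP[_ /and3P[_ _ wC]] tw.
by move: vst vC => /orP[/eqP ->|/eqP ->]; rewrite ?(negbTE sC) // tw -[_ \in _]negbK -finset.in_setC wC.
Qed.

(** Of the factor 3, one unit pays for the heavy colors and two for [rounding]. The path runs
    through vertices all of whose colors are paid for. *)
Lemma cheap_path (X : 'I_m -> nat) D : 0 < D ->
  (forall C, is_separator e sigma s t C -> 9 * D <= \sum_(c in C) X c) ->
  exists p, st_path e s t p /\ D * #|path_colors sigma s p| <= 3 * \sum_c X c.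
Proof.
move=> D_gt0 sepX.
have [s0 ls0] := cm_cell cm s; have [t0 lt0] := cm_cell cm t.
(* A region is a light color or a single obstacle cell, with coordinates up to [N] to include all
   neighbors of labelled cells. Heavy colors become empty regions of weight zero. *)
pose I : finType := ('I_m + 'I_N.+1 * 'I_N.+1)%type.
pose reg (i : I) (z : cell) := match i with
  | inl c => X c < D /\ exists2 v, c \in sigma v & l z = Some v
  | inr (x, y) => z = (x : nat, y : nat) /\ l z = None end.
pose X' (i : I) := if i is inl c then (if X c < D then X c else 0) else 0.
have reg_joined i : joined nb (reg i).
  case: i => [c|[x y]] a b /=; last first.
    by move=> [-> la] [-> lb]; apply: reach_refl.
  move=> [Xc [u cu la]] [_ [v cv lb]].
  pose W := [set v | c \in sigma v].
  have uW : u \in W by rewrite inE.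
  have vW : v \in W by rewrite inE.
  have := lift_connect uW (colors_connected uW vW) la lb.
  by apply: reach_mono => z [w]; rewrite inE => cw lz; split=> //; exists w.
have X'_lt i : X' i < D by case: i => [c|//] /=; case: ifP.
have [q [L [q0 qL q_nb]]] : exists (q : nat -> cell) L,
    [/\ q 0 = s0, q L = t0 & forall k, nb (q k) (q k.+1)].
  apply: (@reach_seq _ nb (fun z => exists2 w, w \in [set: V] & l z = Some w)); first exact: nb_refl.
  apply: (lift_connect (finset.in_setT s) _ ls0 lt0); apply: connect_sub st_connected => x y xy.
  by apply: connect1; rewrite /induced_rel xy !inE.
have sumX' (S : {set I}) (C : {set 'I_m}) : (forall c, c \in C -> X c < D /\ inl c \in S) ->
    \sum_(c in C) X c <= \sum_(i in S) X' i.
  move=> CS; rewrite big_sumType /= big_mkcond [X in _ <= X + _]big_mkcond /=.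
  apply: leq_trans (leq_addr _ _); apply: leq_sum => c _.
  by case: ifP => // /CS[-> ->].
(* The light colors in [S] weigh too little to separate, so some path avoids them; its cells are
   labelled and thus avoid the obstacles too. *)
have even_light (S : {set I}) : \sum_(i in S) X' i < 9 * D ->
    even nb (lam s0 t0) (fun z => exists2 i, i \in S & reg i z).
  move=> SX; pose C := [set c | (X c < D) && (inl c \in S)].
  have : ~~ is_separator e sigma s t C.
    apply/negP => /sepX; rewrite leqNgt; apply/negP; rewrite negbK.
    by apply: leq_ltn_trans SX; apply: sumX' => c; rewrite inE => /andP[].
  rewrite negbK => /andP[sC stC]; apply: even_of_path.
  apply: reach_mono (lift_connect _ stC ls0 lt0); last by rewrite inE.
  move=> z [v]; rewrite !inE negbK => vC lz [[c|[x y]] iS /=]; last by case=> _; rewrite lz.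
  case=> Xc [w cw]; rewrite lz => -[vw]; subst w.
  by move/pred0Pn: vC; apply; exists c; rewrite /= cw inE Xc iS.
have [F [FD F_gt0 F_even]] := @rounding _ nb (lam s0 t0) nb_refl nb_sym I reg X' D
  D_gt0 reg_joined X'_lt s0 t0 q L q0 qL q_nb (@even_of_path s0 t0) even_light.
pose heavy := [set c | D <= X c].
pose Fc := heavy :|: [set c | inl c \in F].
pose W := [set v | sigma v \subset Fc].
(* A color at [s] or [t] is a separator by itself, so it has weight at least [9 * D] and is
   heavy. *)
have endW v : (v == s) || (v == t) -> v \in W.
  move=> vst; rewrite inE; apply/fintype.subsetP => c cv; rewrite !inE.
  have := sepX _ (separator_end vst cv); rewrite big_set1 => XD.
  by rewrite (leq_trans _ XD) // leq_pmull.
have sW : s \in W by apply: endW; rewrite eqxx.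
have tW : t \in W by apply: endW; rewrite eqxx orbT.
have st_reach : reach nb (fun z => exists2 w, w \in W & l z = Some w) s0 t0.
  apply: (even_connect (N := N) F_even); [by exists s|by exists t| |].
    by move=> z [v _ lz]; apply: (cm_box cm); rewrite lz.
  move=> a b [v vW la] ab; case lb: (l b) => [w|]; last first.
    right; have [|a1 a2] := @cm_box cm a; first by rewrite la.
    have [b1 b2] : b.1 < N.+1 /\ b.2 < N.+1.
      move: ab; rewrite /nb /up; case: a a1 a2 {la} => ? ?; case: b {lb} => ? ? /=.
      by rewrite !xpair_eqE; lia.
    exists (inr (Ordinal b1, Ordinal b2)); first by apply/negP => /F_gt0.
    by split=> //=; case: (b).
  have [wW|] := boolP (w \in W); first by left; exists w.
  rewrite inE => /fintype.subsetPn[c cw]; rewrite !inE negb_or -ltnNge => /andP[Xc cF].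
  by right; exists (inl c) => //=; split=> //; exists w.
have [v [_ lt0' /connectP[p pP lp]]] := drop_reach sW ls0 st_reach.
move: lt0'; rewrite lt0 => -[tv]; subst v.
case/shortenP: pP tv => p' p'P p'u _ lp'; exists p'; split.
  by split; [apply: sub_path p'P => x y /and3P[]|split].
have pW x : x \in s :: p' -> x \in W.
  rewrite inE => /orP[/eqP -> //|]; elim: p' (s) p'P {p'u lp'} => //= y p1 IHp x' /andP[/and3P[_ _ yW] p1P].
  by rewrite inE => /orP[/eqP -> //|]; apply: IHp p1P.
have: path_colors sigma s p' \subset Fc.
  rewrite /path_colors; elim: (s :: p') pW => [|y p1 IHp] p1W; first by rewrite big_nil finset.sub0set.
  rewrite big_cons finset.subUset IHp ?andbT; last by move=> x xp; apply: p1W; rewrite inE xp orbT.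
  by have := p1W y; rewrite !inE eqxx => /(_ isT).
move=> /subset_leq_card colF.
have FcD : #|Fc| <= #|heavy| + #|F|.
  apply: leq_trans (leq_card_setU _ _) _; rewrite leq_add2l.
  rewrite -(@card_imset _ _ (@inl 'I_m ('I_N.+1 * 'I_N.+1)%type)); last by move=> x y [].
  by apply: subset_leq_card; apply/fintype.subsetP => i /imsetP[c]; rewrite inE => cF ->.
have heavyD : D * #|heavy| <= \sum_c X c.
  rewrite mulnC -sum_nat_const [leqRHS](bigID (mem heavy)) /=; apply: leq_trans (leq_addr _ _).
  by apply: leq_sum => c; rewrite inE.
have X'X : \sum_i X' i <= \sum_c X c.
  by rewrite big_sumType /= [X in _ + X]big1 // addn0; apply: leq_sum => c _; case: ifP.
apply: leq_trans (leq_mul (leqnn D) (leq_trans colF FcD)) _.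
rewrite mulnDr mulSn leq_add // (leq_trans FD) // leq_mul2l X'X orbT //.
Qed.

End ContactModel.

(** * From drawings to contact models *)

Definition near (k : nat) (a b : cell) :=
  [&& a.1 <= b.1 + k, b.1 <= a.1 + k, a.2 <= b.2 + k & b.2 <= a.2 + k].

Lemma near_refl k a : near k a a.
Proof. by rewrite /near; lia. Qed.

Lemma nb_near a b : nb a b -> near 1 a b.
Proof.
by case: a b => [a1 a2] [b1 b2]; rewrite /nb /up /near xpair_eqE /=; lia.
Qed.

Lemma reach_row (A : cell -> Prop) y i j :
  (forall k, minn i j <= k <= maxn i j -> A (k, y)) -> reach nb A (i, y) (j, y).
Proof.
have step k : nb (k, y) (k.+1, y) by rewrite /nb /up /= !eqxx /= orbT.
have [ij|ji] := leqP i j => Ak; last apply: (reach_sym nb_sym).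
  by apply: (reach_fun (q := fun k => (k, y))).
by apply: (reach_fun (q := fun k => (k, y)) _ (ltnW ji)).
Qed.

Lemma reach_col (A : cell -> Prop) x i j :
  (forall k, minn i j <= k <= maxn i j -> A (x, k)) -> reach nb A (x, i) (x, j).
Proof.
have step k : nb (x, k) (x, k.+1) by rewrite /nb /up /= !eqxx ?orbT.
have [ij|ji] := leqP i j => Ak; last apply: (reach_sym nb_sym).
  by apply: (reach_fun (q := fun k => (x, k))).
by apply: (reach_fun (q := fun k => (x, k)) _ (ltnW ji)).
Qed.

Lemma near_joined M c : joined nb (fun z => near M z c).
Proof.
have toc z : near M z c -> reach nb (fun z => near M z c) z c.
  case: z c => [z1 z2] [c1 c2] zc; apply: (@reach_trans _ _ _ _ (c1, z2)).
    by apply: reach_row => k; move: zc; rewrite /near /=; lia.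
  by apply: reach_col => k; move: zc; rewrite /near /=; lia.
by move=> a b /toc ac /toc bc; apply: reach_trans ac (reach_sym nb_sym bc).
Qed.

Section FirstExit.
Variables (T : Type) (nb' : T -> T -> Prop) (A Q : T -> Prop).

Lemma reach_exit a b : reach nb' A a b -> ~ Q a -> Q b ->
  exists y y', [/\ reach nb' (fun z => A z /\ ~ Q z) a y, nb' y y' & Q y'].
Proof.
move=> ab nQa; have: reach nb' (fun z => A z /\ ~ Q z) a b \/
    exists y y', [/\ reach nb' (fun z => A z /\ ~ Q z) a y, nb' y y' & Q y'].
  elim: ab => [Aa|c d _ [ac|] cd Ad]; [by left; apply: reach_refl| |by right].
  have [Qd|nQd] := pselect (Q d); first by right; exists c, d.
  by left; apply: reach_step ac cd _.
by case=> // ab' Qb; have [_ [_ nQb]] := reach_in ab'.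
Qed.

End FirstExit.

Section Discrete.
Variables (V : finType) (e : rel V) (own : V -> V -> Prop) (c : V -> cell) (M N : nat).
Variable Z : V -> V -> cell -> Prop.
Hypothesis e_sym : symmetric e.
Hypothesis own_edge : forall u v, own u v -> e u v /\ u != v.
Hypothesis edge_own : forall u v, e u v -> u != v -> own u v \/ own v u.
Hypothesis Z_reach : forall u v, own u v -> reach nb (Z u v) (c u) (c v).
Hypothesis c_far : forall u v, u != v -> ~~ near (2 * M + 1) (c u) (c v).
Hypothesis Z_far : forall u v w z, own u v -> Z u v z -> w != u -> w != v -> ~~ near M.+1 z (c w).
Hypothesis Z_disjoint : forall u v u' v' z z', own u v -> own u' v' -> u != u' ->
  Z u v z -> Z u' v' z' -> ~~ near M z (c v) -> ~~ near M z' (c v') -> ~~ near 1 z z'.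
Hypothesis c_box : forall v z, near M z (c v) -> 0 < z.1 < N /\ 0 < z.2 < N.
Hypothesis Z_box : forall u v z, own u v -> Z u v z -> 0 < z.1 < N /\ 0 < z.2 < N.

Let disk v z : Prop := near M z (c v).
(* The cells along an edge belong to one of its ends, up to the first entry into the disk of
   the other end. *)
Let tentacle u z := exists2 v, own u v & reach nb (fun y => Z u v y /\ ~ disk v y) (c u) z.
Let region v z := disk v z \/ tentacle v z.

Let tentacle_in u z : tentacle u z -> exists v, [/\ own u v, Z u v z & ~~ near M z (c v)].
Proof. by move=> [v uv uz]; have [_ [Zz /negP nz]] := reach_in uz; exists v. Qed.

(** Disks are too far apart to touch. A disk meets a foreign tentacle only if the edge of that
    tentacle leads to its vertex, and tentacles with different owners do not touch outside the disks
    of their heads. *)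
Let region_contact a b u v : region u a -> region v b -> nb a b -> u != v -> e u v.
Proof.
have dt x y z z' : disk x z -> tentacle y z' -> nb z z' -> x != y -> e y x.
  move=> dz /tentacle_in[w [yw Zz' nz']] zz' xy.
  have [->|xw] := eqVneq x w; first by case: (own_edge yw).
  case/negP: (Z_far yw Zz' xy xw); move: dz (nb_near zz'); rewrite /disk /near; lia.
move=> [da|ta] [db|tb] ab uv.
- case/negP: (c_far uv); move: da db (nb_near ab); rewrite /disk /near; lia.
- by rewrite e_sym; apply: dt da tb ab uv.
- by apply: dt db ta (nb_sym ab) _; rewrite eq_sym.
have [w [uw Za na]] := tentacle_in ta; have [w' [vw Zb nb']] := tentacle_in tb.
by case/negP: (Z_disjoint uw vw uv Za Zb na nb'); apply: nb_near.
Qed.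

Let region_inj a u v : region u a -> region v a -> u = v.
Proof.
have dt x y : disk x a -> tentacle y a -> x = y.
  move=> da /tentacle_in[w [yw Za na]]; apply/eqP; apply: contraT => xy.
  have [xw|xw] := eqVneq x w; first by case/negP: na; rewrite -xw.
  by case/negP: (Z_far yw Za xy xw); move: da; rewrite /disk /near; lia.
move=> [da|ta] [db|tb]; try by [apply: dt | symmetry; apply: dt].
  apply/eqP; apply: contraT => uv; case/negP: (c_far uv).
  by move: da db; rewrite /disk /near; lia.
apply/eqP; apply: contraT => uv.
have [w [uw Za na]] := tentacle_in ta; have [w' [vw Za' na']] := tentacle_in tb.
by case/negP: (Z_disjoint uw vw uv Za Za' na na'); apply: near_refl.
Qed.

Let region_joined v : joined nb (region v).
Proof.
suff toc z : region v z -> reach nb (region v) (c v) z.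
  by move=> a b /toc ca /toc cb; apply: reach_trans (reach_sym nb_sym ca) cb.
case=> [dz|[w vw cz]].
  by apply: reach_mono (near_joined (near_refl _ _) dz) => y; left.
elim: cz => [[Zc nc]|b d cb IHb bd Zd]; first by apply: reach_refl; left; apply: near_refl.
apply: (reach_step IHb (bd : nb b d)); right; exists w => //; exact: reach_step cb bd Zd.
Qed.

(** The tentacle along an edge stops one step before the disk of the other end, and this step is the
    required contact. *)
Lemma discrete_contact_model : exists l, contact_model e l N.
Proof.
pose l z := if pselect (exists v, region v z) is left h then Some (projT1 (cid h)) else None.
have lP z v : l z = Some v <-> region v z.
  rewrite /l; case: pselect => [h|nh]; last by split=> // rv; case: nh; exists v.
  case: (cid h) => w rw /=; split=> [[<-] //|rv]; congr Some; exact: region_inj rw rv.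
exists l; split.
- by move=> v; exists (c v); apply/lP; left; apply: near_refl.
- move=> v a b /lP ra /lP rb; apply: reach_mono (region_joined ra rb) => z /lP //.
- by move=> a b u v /lP ra /lP rb; apply: region_contact ra rb.
- have own_contact u v : own u v -> exists a b, [/\ l a = Some u, l b = Some v & nb a b].
    move=> uv; have [_ neq] := own_edge uv.
    have [||y [y' [uy yy' vy']]] := @reach_exit _ _ _ (disk v) _ _ (Z_reach uv).
    + by move=> d; case/negP: (c_far neq); move: d; rewrite /disk /near; lia.
    + exact: near_refl.
    by exists y, y'; split=> //; apply/lP; [right; exists v | left].
  move=> u v uv /(edge_own uv)[/own_contact //|/own_contact[a [b [la lb ab]]]].
  by exists b, a; split=> //; apply: nb_sym.
move=> z lz; have [v rv] : exists v, region v z.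
  by case lzE: (l z) => [v|//]; exists v; apply/lP.
have [] : 0 < z.1 < N /\ 0 < z.2 < N; last by split.
by case: rv => [/c_box //|/tentacle_in[w [vw Zz _]]]; apply: Z_box vw Zz.
Qed.
End Discrete.

Local Open Scope ring_scope.

(** * Linear programming duality *)

Section Farkas.
Variables (R : realFieldType) (K : finType).

Definition dot (a x : K -> R) : R := \sum_k a k * x k.

Lemma dot_lin a u v c x : (forall k, a k = u k - c * v k) -> dot a x = dot u x - c * dot v x.
Proof.
move=> aE; rewrite /dot mulr_sumr -sumrB; apply: eq_bigr => k _.
by rewrite aE mulrBl mulrA.
Qed.

Lemma dotC a x : dot a x = dot x a.
Proof. by apply: eq_bigr => k _; rewrite mulrC. Qed.

(* Bartl's induction: eliminate one constraint by projecting along a violating direction. *)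
Lemma farkas (J : finType) (r : seq J) (a : J -> K -> R) (b : K -> R) : uniq r ->
  (forall x, (forall j, j \in r -> dot (a j) x <= 0) -> dot b x <= 0) ->
  exists lam : J -> R, (forall j, 0 <= lam j) /\ forall k, b k = \sum_(j <- r) lam j * a j k.
Proof.
elim: r a b => [|j r IHr] a b /=.
  move=> _ bP; exists (fun=> 0); split=> // k; rewrite big_nil.
  have := bP b (fun j => ltac:(by [])); rewrite /dot => b0.
  have sq0 i : 0 <= b i * b i by rewrite -expr2 sqr_ge0.
  have /eqP : \sum_k b k * b k = 0 by apply/eqP; rewrite eq_le b0 sumr_ge0.
  by rewrite psumr_eq0 // => /allP/(_ k); rewrite mem_index_enum mulf_eq0 orbb => /(_ isT)/eqP.
move=> /andP[jr ur] bP.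
have [br|] := pselect (forall x, (forall i, i \in r -> dot (a i) x <= 0) -> dot b x <= 0).
  have [lam [lam0 bE]] := IHr a b ur br.
  exists (fun i => if i == j then 0 else lam i); split=> [i|k]; first by case: ifP.
  rewrite big_cons eqxx mul0r add0r bE [LHS]big_seq [RHS]big_seq; apply: eq_bigr => i ir.
  by case: eqP => // ij; rewrite -ij ir in jr.
move=> /existsNP[y /not_implyP[ay /negP]]; rewrite -ltNge => by_gt0.
have al_gt0 : 0 < dot (a j) y.
  rewrite ltNge; apply/negP => aj; move: by_gt0; rewrite ltNge; apply/negP; rewrite negbK.
  by apply: bP => i; rewrite inE => /orP[/eqP -> //|/ay].
set al := dot (a j) y in al_gt0.
pose a' i k := a i k - dot (a i) y / al * a j k.
pose b' k := b k - dot b y / al * a j k.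
have [|lam [lam0 b'E]] := IHr a' b' ur.
  (* The projection of [x] along [y] onto the hyperplane where [a j] vanishes. *)
  move=> x a'x; pose x' k := x k - dot (a j) x / al * y k.
  have dx' u : dot u x' = dot u x - dot (a j) x / al * dot u y.
    by rewrite dotC (@dot_lin x' x y (dot (a j) x / al)) // (dotC x) (dotC y).
  have := bP x'; rewrite dx' (@dot_lin b' b (a j) (dot b y / al)) //.
  have -> : dot b x - dot b y / al * dot (a j) x = dot b x - dot (a j) x / al * dot b y by ring.
  apply=> i; rewrite inE => /orP[/eqP ->|ir].
    by rewrite dx' -/al mulfVK ?subrr // gt_eqF.
  have := a'x _ ir; rewrite dx' (@dot_lin (a' i) (a i) (a j) (dot (a i) y / al)) //.
  by have -> : dot (a i) x - dot (a i) y / al * dot (a j) x = dot (a i) x - dot (a j) x / al * dot (a i) y by ring.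
(* [mu] collects the multiples of [a j] subtracted in [a'] and [b']. It is nonnegative because
   [dot (a i) y <= 0] on [r] while [dot b y] and [al] are positive. *)
pose mu := dot b y / al - \sum_(i <- r) lam i * (dot (a i) y / al).
exists (fun i => if i == j then mu else lam i); split=> [i|k].
  case: ifP => // _; rewrite subr_ge0; apply: (@le_trans _ _ 0); last by rewrite divr_ge0 // ltW.
  rewrite big_seq; apply: sumr_le0 => l lr; rewrite mulr_ge0_le0 //.
  by rewrite pmulr_lle0 ?invr_gt0 // ay.
have /eqP := b'E k; rewrite /b' subr_eq => /eqP ->; rewrite big_cons eqxx.
have -> : \sum_(i <- r) (if i == j then mu else lam i) * a i k = \sum_(i <- r) lam i * a i k.
  rewrite big_seq [RHS]big_seq; apply: eq_bigr => i ir.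
  by have -> : i == j = false by apply: contraNF jr => /eqP <-.
have -> : \sum_(i <- r) lam i * a' i k =
    \sum_(i <- r) lam i * a i k - (\sum_(i <- r) lam i * (dot (a i) y / al)) * a j k.
  by rewrite mulr_suml -sumrB; apply: eq_bigr => i _; rewrite /a'; ring.
by rewrite /mu; ring.
Qed.

End Farkas.

(** The coordinate [None] homogenizes the covering problem. If no solution has total strictly below
    [2 * tau], [farkas] yields a packing of value [2 * tau], which exceeds [tau]; the slack 2 is
    what makes strictness affordable. *)
Lemma packing_dual (R : realFieldType) (m : nat) (F : pred {set 'I_m}) (tau : R) : 0 < tau ->
  (forall y : {set 'I_m} -> R, (forall S, 0 <= y S) ->
     (forall c, \sum_(S | F S && (c \in S)) y S <= 1) -> \sum_(S | F S) y S <= tau) ->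
  exists x : 'I_m -> R, [/\ forall c, 0 <= x c, forall S, F S -> 1 <= \sum_(c in S) x c
     & \sum_c x c <= 2 * tau].
Proof.
move=> tau_gt0 tauP.
pose J : finType := ({set 'I_m} + 'I_m)%type.
pose a (j : J) (k : option 'I_m) : R := match j, k with
  | inl A, None => (F A)%:R | inl A, Some c => - (F A && (c \in A))%:R
  | inr _, None => 0 | inr c', Some c => - (c == c')%:R end.
pose b (k : option 'I_m) : R := if k is Some _ then -1 else 2 * tau.
have dotE (u x : option 'I_m -> R) : dot u x = u None * x None + \sum_c u (Some c) * x (Some c).
  rewrite /dot (bigD1 None) //=; congr (_ + _).
  rewrite (@reindex_omap _ _ _ _ _ Some id); last by case.
  by apply: eq_bigl => c; rewrite eqxx.
have [x [ax bx]] : exists x, (forall j, dot (a j) x <= 0) /\ 0 < dot b x.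
  apply: contrapT => nx.
  have [|lam [lam0 bE]] := @farkas R _ J (enum J) a b (enum_uniq J).
    move=> x ax; rewrite leNgt; apply/negP => bx; apply: nx; exists x; split=> // j.
    by apply: ax; rewrite mem_enum.
  have /= := bE None; have /= bS c := bE (Some c).
  have sumS (f : {set 'I_m} -> R) (P : pred {set 'I_m}) :
      \sum_S f S * (P S)%:R = \sum_(S | P S) f S.
    by rewrite [RHS]big_mkcond; apply: eq_bigr => S _; case: (P S); rewrite ?mulr1 ?mulr0.
  rewrite big_enum big_sumType /= sumS [X in _ + X]big1 ?addr0; last by move=> *; rewrite mulr0.
  move=> tauE; have := tauP (fun S => lam (inl S)) (fun S => lam0 _); rewrite -tauE => h.
  have : 2 * tau <= tau; last by lra.
  apply: h => c; move: (bS c); rewrite big_enum big_sumType /=.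
  rewrite (eq_bigr (fun S => - (lam (inl S) * (F S && (c \in S))%:R))); last by move=> *; rewrite mulrN.
  rewrite sumrN sumS (bigD1 c) //= eqxx [X in _ + (_ + X)]big1; last first.
    by move=> c' ne; rewrite eq_sym (negbTE ne) oppr0 mulr0.
  by have := lam0 (inr c); rewrite -[true%:R]/(1 : R); lra.
have x0 c : 0 <= x (Some c).
  have := ax (inr c); rewrite dotE /= mul0r add0r (bigD1 c) //= eqxx big1; first by rewrite -[true%:R]/(1 : R); lra.
  by move=> c' ne; rewrite (negbTE ne) oppr0 mul0r.
have sumx0 : 0 <= \sum_c x (Some c) by apply: sumr_ge0.
have bE : 0 < 2 * tau * x None - \sum_c x (Some c).
  move: bx; rewrite dotE /= (eq_bigr (fun c => - x (Some c))) ?sumrN //.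
  by move=> c _; rewrite mulN1r.
have z_gt0 : 0 < x None.
  rewrite ltNge; apply/negP => z0; have : 2 * tau * x None <= 0 by rewrite pmulr_rle0 // mulr_gt0.
  lra.
exists (fun c => x (Some c) / x None); split=> [c|S FS|].
- by rewrite divr_ge0 // ltW.
- rewrite -mulr_suml ler_pdivlMr // mul1r.
  have := ax (inl S); rewrite dotE /= FS mul1r.
  rewrite (eq_bigr (fun c => - (if c \in S then x (Some c) else 0))).
    by rewrite sumrN -big_mkcond /= subr_le0.
  by move=> c _; case: ifP => /=; rewrite ?mulN1r // oppr0 mul0r.
by rewrite -mulr_suml ler_pdivrMr //; lra.
Qed.

(** Rounding the scaled weights up costs at most 1 per color, which is negligible once [n] exceeds
    [m]. *)
Lemma integral_cover (R : archiRealFieldType) (m : nat) (F : pred {set 'I_m}) (x : 'I_m -> R) (n : nat) :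
  (forall c, 0 <= x c) -> (forall S, F S -> 1 <= \sum_(c in S) x c) ->
  exists X : 'I_m -> nat, (forall S, F S -> (n <= \sum_(c in S) X c)%N) /\
    (\sum_c X c)%:R <= n%:R * \sum_c x c + m%:R.
Proof.
move=> x0 Fx; exists (fun c => (Num.truncn (n%:R * x c)).+1).
have nx0 c : 0 <= n%:R * x c by rewrite mulr_ge0.
split=> [S /Fx xS|].
  rewrite -(ler_nat R) natr_sum; apply: le_trans (_ : n%:R * \sum_(c in S) x c <= _).
    by rewrite ler_peMr.
  by rewrite mulr_sumr; apply: ler_sum => c _; rewrite ltW // truncnS_gt.
have -> : m%:R = \sum_(c < m) 1 :> R by rewrite sumr_const card_ord.
rewrite natr_sum mulr_sumr -big_split /=.
by apply: ler_sum => c _; rewrite -natr1 lerD2r truncn_le.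
Qed.

(** * Approximating the arcs of a drawing by cells *)

Section TopologicalGaps.
Local Open Scope classical_set_scope.

Lemma continuous_fst (T U : topologicalType) : continuous (@fst T U).
Proof. by move=> [x y] A /= Ax; exists (A, setT); [split=> //; apply: filterT | move=> z []]. Qed.

Lemma continuous_snd (T U : topologicalType) : continuous (@snd T U).
Proof. by move=> [x y] A /= Ay; exists (setT, A); [split=> //; apply: filterT | move=> z []]. Qed.

Section Gap.
Variable R : realType.
Implicit Types p q : R * R.

Definition dist p q : R := `|p.1 - q.1| + `|p.2 - q.2|.

Lemma dist_ge0 p q : 0 <= dist p q.
Proof. by rewrite addr_ge0. Qed.

Lemma dist_eq0 p q : dist p q = 0 -> p = q.
Proof.
move/eqP; rewrite paddr_eq0 // !normr_eq0 !subr_eq0 => /andP[/eqP e1 /eqP e2].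
by rewrite [p]surjective_pairing e1 e2 -surjective_pairing.
Qed.

Lemma dist_gt0 p q : p <> q -> 0 < dist p q.
Proof. by move=> pq; rewrite lt_neqAle dist_ge0 andbT eq_sym; apply/eqP => /dist_eq0. Qed.

(** The image of [K] is closed and misses 0, hence misses a ball around 0. *)
Lemma compact_gap (T : topologicalType) (K : set T) (h : T -> R) :
  compact K -> continuous h -> (forall x, K x -> h x != 0) ->
  exists2 d, 0 < d & forall x, K x -> d <= `|h x|.
Proof.
move=> cK ch h0.
have cl : closed (h @` K).
  apply: compact_closed; first exact: norm_hausdorff.
  by apply: continuous_compact => //; apply: continuous_subspaceT.
have op : open (~` (h @` K)) by apply: closed_openC.
have n0 : (~` (h @` K)) 0 by move=> [x Kx hx]; have := h0 x Kx; rewrite hx eqxx.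
have /nbhs_ballP[d /= d0 dP] := open_nbhs_nbhs (conj op n0).
exists d => // x Kx; rewrite leNgt; apply/negP => hd.
by apply: (dP (h x)); [rewrite /ball /= sub0r normrN | exists x].
Qed.

Lemma dist_continuous (T : topologicalType) (f g : T -> R * R) :
  continuous f -> continuous g -> continuous (fun x => dist (f x) (g x)).
Proof.
move=> cf cg x; rewrite /dist.
have c1 (k : T -> R * R) : continuous k -> continuous (fun x => (k x).1).
  by move=> ck y; apply: (@continuous_comp _ _ _ k fst); [exact: ck | exact: continuous_fst].
have c2 (k : T -> R * R) : continuous k -> continuous (fun x => (k x).2).
  by move=> ck y; apply: (@continuous_comp _ _ _ k snd); [exact: ck | exact: continuous_snd].
by apply: cvgD; apply: cvg_norm; apply: cvgB; [apply: c1|apply: c1|apply: c2|apply: c2].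
Qed.

(** Precomposition with this retraction turns continuity within the unit segment into continuity on
    the line. *)
Definition clamp (x : R) : R := Num.min 1 (Num.max 0 x).

Lemma clamp_in x : 0 <= clamp x <= 1.
Proof. by rewrite le_min ler01 le_max lexx ge_min lexx. Qed.

Lemma clamp_id x : 0 <= x <= 1 -> clamp x = x.
Proof. by move=> /andP[x0 x1]; rewrite /clamp max_r // min_r. Qed.

Lemma clamp_continuous (f : R -> R * R) : {within [set x : R | 0 <= x <= 1], continuous f} ->
  continuous (f \o clamp).
Proof.
move=> cf x; set A := [set _ | _] in cf.
have cc : {for x, continuous clamp}.
  have c0 : {for x, continuous ((fun=> 0 : R^o) \max (@id R^o))}.
    by apply: continuous_max; [exact: cvg_cst | exact: cvg_id].
  by apply: (@continuous_min R _ (fun=> 1 : R^o) _ x _ c0); exact: cvg_cst.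
have cw : clamp @ x --> within A (nbhs (clamp x)).
  move=> U /cc hU; apply: (@filterS _ (nbhs x) _ (clamp @^-1` [set y | A y -> U y])) => //.
  by move=> y h; exact: h (clamp_in y).
exact: cvg_comp cw ((subspace_continuousP _ _).1 cf _ (clamp_in x : A (clamp x))).
Qed.

Let seg := [set x : R | 0 <= x <= 1].

Let seg_compact : compact seg.
Proof.
have -> : seg = `[0, 1] by apply/seteqP; split => x; rewrite /seg /= in_itv.
exact: segment_compact.
Qed.

Lemma arc_point_gap (f : R -> R * R) p : continuous f ->
  (forall x, 0 <= x <= 1 -> f x <> p) ->
  exists2 d, 0 < d & forall x, 0 <= x <= 1 -> d <= dist (f x) p.
Proof.
move=> cf fp; have cp : continuous (fun _ : R => p : R * R) by move=> x; apply: cvg_cst.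
have [|d d0 dP] := compact_gap seg_compact (dist_continuous cf cp).
  by move=> x sx; apply: lt0r_neq0; apply: dist_gt0; exact: fp sx.
by exists d => // x /dP; rewrite ger0_norm // dist_ge0.
Qed.

(** Arcs may share end points; staying [e] away from [p] and [q] leaves a compact set of parameter
    pairs on which the distance is positive. *)
Lemma arc_arc_gap (f g : R -> R * R) p q e : continuous f -> continuous g ->
  (forall x y, 0 <= x <= 1 -> 0 <= y <= 1 -> e <= dist (f x) p -> e <= dist (g y) q -> f x <> g y) ->
  exists2 d, 0 < d & forall x y, 0 <= x <= 1 -> 0 <= y <= 1 ->
    e <= dist (f x) p -> e <= dist (g y) q -> d <= dist (f x) (g y).
Proof.
move=> cf cg fg.
have cst r : continuous (fun _ : R * R => r : R * R) by move=> x; apply: cvg_cst.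
have cf1 : continuous (fun z : R * R => f z.1).
  by move=> x; apply: (@continuous_comp _ _ _ fst f); [exact: continuous_fst | exact: cf].
have cg2 : continuous (fun z : R * R => g z.2).
  by move=> x; apply: (@continuous_comp _ _ _ snd g); [exact: continuous_snd | exact: cg].
pose K := (seg `*` seg) `&` ([set z | e <= dist (f z.1) p] `&` [set z | e <= dist (g z.2) q]).
have cK : compact K.
  apply: compact_closedI; first exact: compact_setX.
  have cl := @closed_ge R e.
  apply: closedI; apply: (preimage_closed _ cl) => z _; apply: dist_continuous;
    solve [exact: cst | exact: cf1 | exact: cg2].
have [|d d0 dP] := compact_gap cK (dist_continuous cf1 cg2).
  by move=> [x y] [[/= sx sy] [/= fx gy]]; apply: lt0r_neq0; apply: dist_gt0; exact: fg.
exists d => // x y sx sy fx gy; have := dP (x, y) (conj (conj sx sy) (conj fx gy)).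
by rewrite ger0_norm // dist_ge0.
Qed.

(** [compact_gap] for [x - y] on the compact set of pairs whose images are at least [e] apart. *)
Lemma arc_uniform (f : R -> R * R) e : continuous f -> 0 < e ->
  exists2 d, 0 < d & forall x y, 0 <= x <= 1 -> 0 <= y <= 1 -> `|x - y| < d -> dist (f x) (f y) < e.
Proof.
move=> cf e0.
have cf1 : continuous (fun z : R * R => f z.1).
  by move=> x; apply: (@continuous_comp _ _ _ fst f); [exact: continuous_fst | exact: cf].
have cf2 : continuous (fun z : R * R => f z.2).
  by move=> x; apply: (@continuous_comp _ _ _ snd f); [exact: continuous_snd | exact: cf].
pose K := (seg `*` seg) `&` [set z | e <= dist (f z.1) (f z.2)].
have cK : compact K.
  apply: compact_closedI; first exact: compact_setX.
  by apply: (preimage_closed _ (@closed_ge R e)) => z _; apply: dist_continuous.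
have cB : continuous (fun z : R * R => z.1 - z.2).
  by move=> z; apply: cvgB; [apply: continuous_fst | apply: continuous_snd].
have [|d d0 dP] := compact_gap cK cB.
  move=> [x y] [_ /= exy]; apply/negP; rewrite subr_eq0 => /eqP xy; move: exy.
  by rewrite xy /dist !subrr normr0 addr0 leNgt e0.
exists d => // x y sx sy xyd; rewrite ltNge; apply/negP => exy.
by have := dP (x, y) (conj (conj sx sy) exy); rewrite /= leNgt xyd.
Qed.

Lemma arc_bounded (f : R -> R * R) : continuous f ->
  exists B, forall x, 0 <= x <= 1 -> `|(f x).1| <= B /\ `|(f x).2| <= B.
Proof.
move=> cf; have c0 : continuous (fun _ : R => 0 : R * R) by move=> x; apply: cvg_cst.
have cd := dist_continuous cf c0.
have [c _ cP] := @EVT_max R _ 0 1 ler01 (continuous_subspaceT cd).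
exists (dist (f c) 0) => x sx; have := cP x; rewrite in_itv /= => /(_ sx).
by rewrite {1}/dist /= !subr0; have := normr_ge0 (f x).1; have := normr_ge0 (f x).2; lra.
Qed.

End Gap.

End TopologicalGaps.

Section LatticeRounding.
Variable R : realType.
Implicit Types p q : R * R.

Lemma common_gap (I : finType) (P : I -> R -> Prop) :
  (forall i d d', P i d -> d' <= d -> P i d') -> (forall i, exists2 d, 0 < d & P i d) ->
  exists2 d, 0 < d & forall i, P i d.
Proof.
move=> Pdown Pex; have /choice[f fP'] : forall i, exists d, 0 < d /\ P i d.
  by move=> i; have [d] := Pex i; exists d.
have f0 i : 0 < f i by case: (fP' i).
have fP i : P i (f i) by case: (fP' i).
(* [T^-1] is at most every [f i]; the summand 1 keeps it meaningful when [I] is empty. *)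
pose T := 1 + \sum_i (f i)^-1.
have s0 (Q : pred I) : 0 <= \sum_(i | Q i) (f i)^-1.
  by apply: sumr_ge0 => j _; rewrite invr_ge0 ltW.
have T0 : 0 < T by rewrite ltr_pwDl // (s0 predT).
exists T^-1; first by rewrite invr_gt0.
move=> i; apply: Pdown (fP i) _; rewrite invf_ple ?posrE // /T (bigD1 i) //=.
by rewrite addrCA lerDl addr_ge0.
Qed.

Lemma common_bound (I : finType) (P : I -> R -> Prop) :
  (forall i B B', P i B -> B <= B' -> P i B') -> (forall i, exists B, P i B) ->
  exists B, forall i, P i B.
Proof.
move=> Pup /choice[f fP]; exists (\sum_i `|f i|) => i.
apply: Pup (fP i) _; rewrite (bigD1 i) //=; apply: le_trans (ler_norm _) _.
by rewrite lerDl sumr_ge0.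
Qed.

Variables (S B : R).
Hypothesis S_gt0 : 0 < S.

(** The plane is scaled by [S] and shifted by [B] in both coordinates, so that the drawing falls
    into the quadrant of cells. *)
Definition close (r : R) (z : cell) p :=
  `|z.1%:R - (S * p.1 + B)| <= r /\ `|z.2%:R - (S * p.2 + B)| <= r.

Lemma scaled_dist p q : S * dist p q = `|S * p.1 - S * q.1| + `|S * p.2 - S * q.2|.
Proof. by rewrite /dist mulrDr -!mulrBr !normrM (gtr0_norm S_gt0). Qed.

(** The factor 2 arises because [dist] adds the coordinates while [near] and [close] bound each
    one. *)
Lemma close_near k z z' p p' r r' : close r z p -> close r' z' p' -> near k z z' ->
  S * dist p p' <= 2 * (k%:R + r + r').
Proof.
move=> [z1 z2] [z1' z2'] /and4P[].
rewrite -!(ler_nat R) !natrD scaled_dist => n1 n2 n3 n4.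
move: z1 z2 z1' z2'; rewrite !ler_norml => /andP[? ?] /andP[? ?] /andP[? ?] /andP[? ?].
have -> : 2 * (k%:R + r + r') = (k%:R + r + r') + (k%:R + r + r') by ring.
by apply: lerD; rewrite ler_norml; apply/andP; split; lra.
Qed.

Lemma close_not_near k z z' p p' r r' : close r z p -> close r' z' p' -> ~~ near k z z' ->
  k%:R + 1 <= S * dist p p' + r + r'.
Proof.
move=> [z1 z2] [z1' z2']; rewrite scaled_dist.
have := normr_ge0 (S * p.1 - S * p'.1); have := normr_ge0 (S * p.2 - S * p'.2).
have := ler_norm (S * p.1 - S * p'.1); have := ler_norm (S * p.2 - S * p'.2).
have := ler_norm (- (S * p.1 - S * p'.1)); have := ler_norm (- (S * p.2 - S * p'.2)).
rewrite !normrN => h1 h2 h3 h4 h5 h6.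
move: z1 z2 z1' z2'; rewrite !ler_norml => /andP[? ?] /andP[? ?] /andP[? ?] /andP[? ?].
rewrite !negb_and -!ltnNge => /or4P[]; rewrite -(ler_nat R) -natr1 natrD => n1; lra.
Qed.

Definition cell_of p : cell := (Num.truncn (S * p.1 + B), Num.truncn (S * p.2 + B)).

Lemma close_cell_of p : 0 <= S * p.1 + B -> 0 <= S * p.2 + B -> close 1 (cell_of p) p.
Proof.
move=> p1 p2; rewrite /close /cell_of /= !ler_norml.
have := truncn_le (S * p.1 + B); have := truncn_le (S * p.2 + B); rewrite p1 p2.
have := truncnS_gt (S * p.1 + B); have := truncnS_gt (S * p.2 + B).
by rewrite -!natr1 => *; split; apply/andP; split; lra.
Qed.

(* Consecutive cells are joined by an axis-parallel elbow, since they may be antidiagonal. *)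
Lemma reach_elbow (Z : cell -> Prop) p q :
  (forall z, close 2 z p -> Z z) ->
  0 <= S * p.1 + B -> 0 <= S * p.2 + B -> 0 <= S * q.1 + B -> 0 <= S * q.2 + B ->
  S * dist p q <= 1 -> reach nb Z (cell_of p) (cell_of q).
Proof.
have mid (i j k : nat) : (minn i j <= k <= maxn i j)%N ->
    (i%:R <= k%:R :> R) && (k%:R <= j%:R :> R) || (j%:R <= k%:R :> R) && (k%:R <= i%:R :> R).
  by clear; rewrite !ler_nat; lia.
move=> Zp p1 p2 q1 q2; rewrite scaled_dist => pq.
have [a1 a2] := close_cell_of p1 p2; have [b1 b2] := close_cell_of q1 q2.
have d1 : `|S * p.1 - S * q.1| <= 1 by have := normr_ge0 (S * p.2 - S * q.2); lra.
have d2 : `|S * p.2 - S * q.2| <= 1 by have := normr_ge0 (S * p.1 - S * q.1); lra.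
move: a1 a2 b1 b2 d1 d2; case: (cell_of p) (cell_of q) => [a1 a2] [b1 b2] /=.
rewrite !ler_norml => /andP[? ?] /andP[? ?] /andP[? ?] /andP[? ?] /andP[? ?] /andP[? ?].
apply: (@reach_trans _ _ _ _ (b1, a2)).
  apply: reach_row => k /mid km; apply: Zp; split=> /=; rewrite ler_norml; apply/andP; split;
    by case/orP: km => /andP[? ?]; lra.
apply: reach_col => k /mid km; apply: Zp; split=> /=; rewrite ler_norml; apply/andP; split;
  by case/orP: km => /andP[? ?]; lra.
Qed.

(** By uniform continuity the arc is sampled so finely that consecutive points are at scaled
    distance below 1 and an elbow joins their cells. *)
Lemma reach_arc (f : R -> R * R) (Z : cell -> Prop) : continuous f ->
  (forall x, 0 <= x <= 1 -> 0 <= S * (f x).1 + B /\ 0 <= S * (f x).2 + B) ->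
  (forall x z, 0 <= x <= 1 -> close 2 z (f x) -> Z z) ->
  reach nb Z (cell_of (f 0)) (cell_of (f 1)).
Proof.
move=> cf f_pos Zf.
have [|d d0 dP] := arc_uniform cf (e := S^-1); first by rewrite invr_gt0.
pose n := (Num.truncn d^-1).+1.
have n0 : 0 < n%:R :> R by rewrite ltr0n.
have nd : n%:R^-1 < d by rewrite invf_plt ?posrE // truncnS_gt.
have xk k : (k <= n)%N -> (0 <= k%:R / n%:R :> R) && (k%:R / n%:R <= 1 :> R).
  by move=> kn; rewrite divr_ge0 //= ler_pdivrMr // mul1r ler_nat.
suff: forall k, (k <= n)%N -> reach nb Z (cell_of (f 0)) (cell_of (f (k%:R / n%:R))).
  by move/(_ n (leqnn _)); rewrite divff // gt_eqF.
elim=> [_|k IHk kn].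
  rewrite mul0r; have x0 : (0 <= 0 :> R) && (0 <= 1 :> R) by rewrite lexx ler01.
  have [p1 p2] := f_pos _ x0; apply: reach_refl; apply: (Zf _ _ x0).
  by have [h1 h2] := close_cell_of p1 p2; split; lra.
apply: reach_trans (IHk (ltnW kn)) _.
have xk0 := xk _ (ltnW kn); have xk1 := xk _ kn.
have [p1 p2] := f_pos _ xk0; have [q1 q2] := f_pos _ xk1.
apply: reach_elbow => //; first by move=> z; apply: Zf.
apply: ltW; rewrite mulrC -ltr_pdivlMr // mul1r; apply: dP => //.
by rewrite -mulrBl -natr1 opprD addrA subrr sub0r mulN1r normrN gtr0_norm ?invr_gt0.
Qed.

End LatticeRounding.

Section Drawing.
Variables (R : realType) (V : finType) (e : rel V) (pos : V -> R * R) (f : V -> V -> R -> R * R).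
Variable own : V -> V -> Prop.
Hypothesis e_sym : symmetric e.
Hypothesis pos_inj : injective pos.
Hypothesis own_edge : forall u v, own u v -> e u v /\ u != v.
Hypothesis edge_own : forall u v, e u v -> u != v -> own u v \/ own v u.
Hypothesis f_cont : forall u v, own u v -> continuous (f u v).
Hypothesis f0 : forall u v, own u v -> f u v 0 = pos u.
Hypothesis f1 : forall u v, own u v -> f u v 1 = pos v.
Hypothesis f_pos : forall u v x w, own u v -> 0 < x < 1 -> f u v x <> pos w.
Hypothesis f_disjoint : forall u v u' v' x y, own u v -> own u' v' -> u != u' ->
  0 < x < 1 -> 0 < y < 1 -> f u v x <> f u' v' y.

Let interior (x : R) : 0 <= x <= 1 -> [\/ x = 0, x = 1 | 0 < x < 1].
Proof.
rewrite !le_eqVlt => /andP[/orP[/eqP <-|x0] /orP[/eqP x1|x1]]; [exact: Or31|exact: Or31| exact: Or32|].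
by apply: Or33; rewrite x0 x1.
Qed.

Let f_vertex u v w x : own u v -> w != u -> w != v -> 0 <= x <= 1 -> f u v x <> pos w.
Proof.
move=> uv wu wv /interior[->|->|x01]; last exact: f_pos.
- by rewrite f0 // => /pos_inj uw; rewrite uw eqxx in wu.
- by rewrite f1 // => /pos_inj vw; rewrite vw eqxx in wv.
Qed.

(** Two edges with different tails can only meet at a point that is the head of one of them, and
    heads are excluded by the distance [d]. *)
Let f_apart u v u' v' x y d : 0 < d -> own u v -> own u' v' -> u != u' ->
  0 <= x <= 1 -> 0 <= y <= 1 -> d <= dist (f u v x) (pos v) -> d <= dist (f u' v' y) (pos v') ->
  f u v x <> f u' v' y.
Proof.
have dist0 (p : R * R) : dist p p = 0 by rewrite /dist !subrr normr0 addr0.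
move=> d0 uv uv' uu' /interior[->|->|x01] /interior[->|->|y01];
  rewrite ?f1 // ?dist0 ?(leNgt d) ?d0 //= => _ _.
- by rewrite !f0 // => /pos_inj uu; rewrite uu eqxx in uu'.
- by rewrite f0 // => /esym; apply: f_pos.
- by rewrite (f0 uv'); apply: f_pos.
exact: f_disjoint.
Qed.

Lemma drawing_contact_model : exists l N, contact_model e l N.
Proof.
have [d0 d0_gt0 d0P] : exists2 d : R, 0 < d & forall i : V * V * V,
    (i.1.1 != i.2 -> d <= dist (pos i.1.1) (pos i.2)) /\
    (own i.1.1 i.1.2 -> i.2 != i.1.1 -> i.2 != i.1.2 ->
      forall x, 0 <= x <= 1 -> d <= dist (f i.1.1 i.1.2 x) (pos i.2)).
  apply: common_gap => [i d d' [P1 P2] d'd|[[u v] w] /=].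
    by split=> *; apply: le_trans d'd _; [apply: P1 | apply: P2].
  have [d1 d1_gt0 d1P] : exists2 d : R, 0 < d & u != w -> d <= dist (pos u) (pos w).
    have [uw|uw] := eqVneq u w; first by exists 1.
    by exists (dist (pos u) (pos w)) => //; apply: dist_gt0 => /pos_inj uw'; rewrite uw' eqxx in uw.
  have [[uv [wu wv]]|no] := pselect (own u v /\ w != u /\ w != v); last first.
    by exists d1 => //; split=> // uv wu wv; case: no.
  have [d2 d2_gt0 d2P] := arc_point_gap (f_cont uv) (fun x => @f_vertex u v w x uv wu wv).
  exists (Num.min d1 d2); first by rewrite lt_min d1_gt0.
  by split=> [/d1P|_ _ _ x /d2P]; apply: le_trans; rewrite ge_min lexx ?orbT.
pose d := d0 / 10; have d_gt0 : 0 < d by rewrite divr_gt0.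
have [g g_gt0 gP] : exists2 g : R, 0 < g & forall i : (V * V) * (V * V),
    own i.1.1 i.1.2 -> own i.2.1 i.2.2 -> i.1.1 != i.2.1 ->
    forall x y, 0 <= x <= 1 -> 0 <= y <= 1 -> d <= dist (f i.1.1 i.1.2 x) (pos i.1.2) ->
      d <= dist (f i.2.1 i.2.2 y) (pos i.2.2) -> g <= dist (f i.1.1 i.1.2 x) (f i.2.1 i.2.2 y).
  apply: common_gap => [i g g' P g'g *|[[u v] [u' v']] /=].
    by apply: le_trans g'g _; apply: P.
  have [[uv [uv' uu']]|no] := pselect (own u v /\ own u' v' /\ u != u'); last first.
    by exists 1 => // uv uv' uu'; case: no.
  have [|g g_gt0 gP] := @arc_arc_gap R _ _ (pos v) (pos v') d (f_cont uv) (f_cont uv').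
    by move=> x y *; apply: (@f_apart u v u' v' x y d).
  by exists g => // _ _ _; apply: gP.
have [D DP] : exists D : R, forall i : V * V,
    (`|(pos i.1).1| <= D /\ `|(pos i.1).2| <= D) /\
    (own i.1 i.2 -> forall x, 0 <= x <= 1 -> `|(f i.1 i.2 x).1| <= D /\ `|(f i.1 i.2 x).2| <= D).
  apply: common_bound => [i D D' [[P1 P2] P3] DD'|[u v] /=].
    split=> [|iv x x01]; first by split; apply: le_trans DD'.
    by have [h1 h2] := P3 iv x x01; split; apply: le_trans DD'.
  pose D0 := `|(pos u).1| + `|(pos u).2|.
  have D0P : `|(pos u).1| <= D0 /\ `|(pos u).2| <= D0 by rewrite /D0 lerDl lerDr.
  have D00 : 0 <= D0 by rewrite addr_ge0.
  have [uv|nuv] := pselect (own u v); last by exists D0; split.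
  have [D1 D1P] := arc_bounded (f_cont uv).
  exists (D0 + `|D1|); split=> [|_ x /D1P[h1 h2]].
    have D01 : D0 <= D0 + `|D1| by rewrite lerDl.
    by case: D0P => h1 h2; split; apply: le_trans D01.
  by split; [apply: le_trans h1 _ | apply: le_trans h2 _]; apply: le_trans (ler_norm _) _; rewrite lerDr.
(* Touching cells within 2 of two arcs come from points at scaled distance at most 10, which
   [S * g > 11] rules out. [S * d > 10] makes [S * d0] exceed the disk sizes and rounding errors. *)
pose S := 11 / g + 10 / d.
have Sg : 11 < S * g by rewrite /S mulrDl divfK ?gt_eqF // ltrDl mulr_gt0 // divr_gt0.
have Sd : 10 < S * d by rewrite /S mulrDl (divfK (lt0r_neq0 d_gt0)) ltrDr mulr_gt0 // divr_gt0.
have S_gt0 : 0 < S by rewrite addr_gt0 // divr_gt0.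
have Sd0 : S * d0 = 10 * (S * d) by rewrite /d; field.
pose M := (Num.truncn (S * d) + 3)%N.
have [M_ge M_le] : S * d + 2 <= M%:R /\ M%:R <= S * d + 3.
  have := truncn_le (S * d); have := truncnS_gt (S * d).
  rewrite (ltW (mulr_gt0 S_gt0 d_gt0)) /M -natr1 natrD; lra.
pose B : R := S * D + M%:R + 5.
pose N := ((Num.truncn (S * D + B)).+1 + M + 10)%N.
have N_gt : S * D + B + M%:R + 10 < N%:R.
  by rewrite /N !natrD; have := truncnS_gt (S * D + B); lra.
have bnd (x : R) : `|x| <= D -> M%:R + 5 <= S * x + B /\ S * x + B <= S * D + B.
  rewrite ler_norml => /andP[x1 x2].
  have := ler_wpM2l (ltW S_gt0) x1; have := ler_wpM2l (ltW S_gt0) x2.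
  by rewrite /B mulrN; lra.
have M0 : 0 <= M%:R :> R by [].
have box z (p : R * R) r : close S B r z p -> `|p.1| <= D -> `|p.2| <= D -> r <= M%:R + 4 ->
    (0 < z.1 < N)%N /\ (0 < z.2 < N)%N.
  move=> [z1 z2] /bnd[h1 h2] /bnd[h3 h4] rM.
  move: z1 z2; rewrite !ler_norml => /andP[? ?] /andP[? ?].
  by rewrite -!(ltr_nat R); split; apply/andP; split; lra.
pose c v := cell_of S B (pos v).
pose Z u v z := exists2 x, 0 <= x <= 1 & close S B 2 z (f u v x).
have posD v : `|(pos v).1| <= D /\ `|(pos v).2| <= D by have [] := DP (v, v).
have cc v : close S B 1 (c v) (pos v).
  by have [/bnd[h1 _] /bnd[h2 _]] := posD v; apply: close_cell_of; lra.
have fD u v x : own u v -> 0 <= x <= 1 -> `|(f u v x).1| <= D /\ `|(f u v x).2| <= D.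
  by have [_ /= h] := DP (u, v) => uv; apply: h.
have d0_pos u v : u != v -> d0 <= dist (pos u) (pos v) by have [h _] := d0P (u, u, v); apply: h.
have S_le a b : a <= b -> S * a <= S * b by rewrite ler_pM2l.
have [||||||l lP] := @discrete_contact_model V e own c M N Z e_sym own_edge edge_own.
- move=> u v uv; rewrite /c -(f0 uv) -(f1 uv); apply: reach_arc => //; first exact: f_cont.
    by move=> x x01; have [/bnd[h1 _] /bnd[h2 _]] := fD u v x uv x01; split; lra.
  by move=> x z x01 xz; exists x.
- move=> u v uv; apply/negP => /(close_near S_gt0 (cc u) (cc v)).
  by have := S_le _ _ (d0_pos _ _ uv); rewrite Sd0 natrD natrM; lra.
- move=> u v w z uv [x x01 xz] wu wv; apply/negP => /(close_near S_gt0 xz (cc w)).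
  have [_ /(_ uv wu wv x x01) /S_le] := d0P (u, v, w); rewrite Sd0 -natr1 /=; lra.
- move=> u v u' v' z z' uv uv' uu' [x x01 xz] [y y01 yz] nz nz'; apply/negP => zz'.
  have dx : d <= dist (f u v x) (pos v).
    by rewrite -(ler_pM2l S_gt0); have := close_not_near S_gt0 xz (cc v) nz; lra.
  have dy : d <= dist (f u' v' y) (pos v').
    by rewrite -(ler_pM2l S_gt0); have := close_not_near S_gt0 yz (cc v') nz'; lra.
  have /S_le := gP ((u, v), (u', v')) uv uv' uu' x y x01 y01 dx dy.
  by have := close_near S_gt0 xz yz zz'; lra.
- move=> v z zv; have [p1 p2] := posD v.
  apply: (box z (pos v) (M%:R + 1)) => //; last by lra.
  have [c1 c2] := cc v; move: zv c1 c2 => /and4P[]; rewrite -!(ler_nat R) !natrD /close !ler_norml.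
  by move=> ? ? ? ? /andP[? ?] /andP[? ?]; split; apply/andP; split; lra.
- move=> u v z uv [x x01 xz]; have [p1 p2] := fD u v x uv x01.
  by apply: (box z _ 2 xz) => //; lra.
by exists l, N.
Qed.

End Drawing.

(** [arc u v] and [arc v u] may cross, so only the one from lower to higher rank is kept. Kept arcs
    with different tails then belong to different vertex pairs. *)
Lemma planar_contact_model (V : finType) (e : rel V) : symmetric e -> planar e ->
  exists l N, contact_model e l N.
Proof.
move=> e_sym [pos [arc [pos_inj [arcP arc_disjoint]]]].
pose own u v := [/\ e u v, u != v & (enum_rank u < enum_rank v)%N].
have arc_clamp u v x : 0 < x < 1 -> (arc u v \o @clamp realR) x = arc u v x.
  by move=> /andP[x0 x1] /=; rewrite clamp_id // !ltW.
apply: (@drawing_contact_model realR V e pos (fun u v => arc u v \o @clamp realR) own) => //.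
- by move=> u v [].
- move=> u v uv neq; have [lt|gt|eq] := ltngtP (enum_rank u) (enum_rank v).
  + by left.
  + by right; split; rewrite // 1?e_sym // eq_sym.
  by case/eqP: neq; apply: enum_rank_inj; apply: val_inj.
- by move=> u v [uv neq _]; apply: clamp_continuous; have [] := arcP u v uv neq.
- by move=> u v [uv neq _] /=; rewrite clamp_id ?lexx ?ler01 //; have [] := arcP u v uv neq.
- by move=> u v [uv neq _] /=; rewrite clamp_id ?lexx ?ler01 //; have [] := arcP u v uv neq.
- move=> u v x w [uv neq _] x01; rewrite arc_clamp //.
  by have [_ _ _ _] := arcP u v uv neq; apply.
move=> u v u' v' x y [uv neq lt] [uv' neq' lt'] uu' x01 y01; rewrite !arc_clamp //.
apply: arc_disjoint => //; apply/eqP => E.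
have [/= uu|uv2] : [set u'; v']%classic u by rewrite -E; left.
  by rewrite uu eqxx in uu'.
have [/= uu|vu2] : [set u; v]%classic u' by rewrite E; left.
  by rewrite uu eqxx in uu'.
by move: lt lt'; rewrite uv2 vu2 => lt lt'; have := ltn_trans lt lt'; rewrite ltnn.
Qed.

(** * Fractional packings and optimal paths *)

Section MinColorPathBounds.
Variables (V : finType) (e : rel V) (m : nat) (sigma : V -> {set 'I_m}) (s t : V).

Lemma path_meets_separator p S : st_path e s t p -> is_separator e sigma s t S ->
  exists2 c, c \in S & c \in path_colors sigma s p.
Proof.
move=> [pP [lp _]] sepS; apply/exists2P; apply: contrapT => /forallNP none.
have disj v : v \in s :: p -> v \notin Vcol sigma S.
  move=> vp; rewrite inE negbK; apply/pred0P => c /=; apply/negP => /andP[cv cS].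
  apply: (none c); split=> //; rewrite /path_colors.
  elim: (s :: p) vp => //= v' q IHq; rewrite big_cons !inE => /orP[/eqP <-|/IHq ->]; first by rewrite cv.
  by rewrite orbT.
move: sepS; rewrite /is_separator disj ?inE ?eqxx //= => /negP; apply.
apply/connectP; exists p => //; elim: p (s) pP {lp none} disj => //= w q IHq v /andP[vw wq] disj.
rewrite /induced_rel vw !finset.in_setC !disj ?inE ?eqxx ?orbT //=.
by apply: IHq => // v' v'q; apply: disj; rewrite inE v'q orbT.
Qed.

(** Weak duality: every separator shares a color with the path, and each color of the path carries
    load at most 1. *)
Lemma packing_le_colors p (y : {set 'I_m} -> realR) : st_path e s t p ->
  frac_packing e sigma s t y -> packing_value e sigma s t y <= #|path_colors sigma s p|%:R.
Proof.
move=> pP [y01 yc]; set Q := path_colors sigma s p.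
apply: (@le_trans _ _ (\sum_(c in Q) \sum_(S : {set 'I_m} | is_separator e sigma s t S && (c \in S)) y S)).
  rewrite (exchange_big_dep (fun S => is_separator e sigma s t S)) /=; last by move=> c S _ /andP[].
  apply: ler_sum => S sepS; have [c cS cQ] := path_meets_separator pP sepS.
  have /andP[y0 _] := y01 S sepS.
  rewrite (bigD1 c) /=; last by rewrite cQ sepS cS.
  by rewrite lerDl sumr_ge0.
by rewrite -sum1_card natr_sum; apply: ler_sum => c _; apply: yc.
Qed.

Lemma separator_nonempty S : connect e s t -> is_separator e sigma s t S -> exists c, c \in S.
Proof.
move=> /connectP[p pP lp] sepS.
case/shortenP: pP lp => p' p'P p'u _ lp.
have [c cS _] := path_meets_separator (conj p'P (conj (esym lp) p'u)) sepS.
by exists c.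
Qed.

Lemma tau_ge1 S tau : connect e s t -> is_separator e sigma s t S -> is_tau e sigma s t tau -> 1 <= tau.
Proof.
move=> st sepS [_ tau_max]; pose y A : realR := (A == S)%:R.
have sum_y (P : pred {set 'I_m}) : \sum_(A | P A) y A = (P S)%:R.
  rewrite big_mkcond (bigD1 S) //= big1 ?addr0 => [|A AS]; last by rewrite /y (negbTE AS); case: ifP.
  by rewrite /y eqxx; case: (P S).
have := tau_max y; rewrite /packing_value (sum_y (is_separator e sigma s t)) sepS; apply; split.
  by move=> A _; rewrite /y; case: (A == S); rewrite /= ?lexx ?ler01.
by move=> c; rewrite (sum_y (fun A => is_separator e sigma s t A && (c \in A))); case: (_ && _).
Qed.

(** The integral weights total at most [9 * D * (2 * tau) + m], and [cheap_path] multiplies by 3 and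
    divides by [D]. As [m < D] and [1 <= tau], this is at most [54 * tau + 3], hence at most
    [57 * tau]. *)
Lemma opt_le_tau tau k : symmetric e -> planar e -> color_connected e sigma -> connect e s t ->
  is_OPT e sigma s t k -> is_tau e sigma s t tau -> k%:R <= 57 * tau.
Proof.
move=> e_sym e_planar colors st [_ k_min] tauP.
have [l [N cm]] := planar_contact_model e_sym e_planar.
have short := cheap_path cm colors st.
(* Without separators the zero weights are admissible and give a path without colors. *)
have [[S sepS]|no_sep] := pselect (exists S, is_separator e sigma s t S); last first.
  have [|p [pP]] := short (fun=> 0%N) 1%N isT.
    by move=> C sepC; case: no_sep; exists C.
  rewrite mul1n big1 // muln0 leqn0 => /eqP p0.
  have := k_min p pP; rewrite p0 leqn0 => /eqP ->; rewrite mulr_ge0 //.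
  have := tauP.2 (fun=> 0); rewrite /packing_value big1 //; apply; split.
    by move=> A _; rewrite lexx ler01.
  by move=> c; rewrite big1.
have tau1 := tau_ge1 st sepS tauP.
have tau0 : 0 < tau by apply: lt_le_trans tau1.
have [|x [x0 xS x_le]] := @packing_dual realR m (is_separator e sigma s t) tau tau0.
  (* The bound [y A <= 1] follows from the packing constraint at any color of [A]. *)
  move=> y y0 yc; apply: tauP.2; split=> // A sepA; rewrite y0 /=.
  have [c cA] := separator_nonempty st sepA; apply: le_trans (yc c).
  by rewrite (bigD1 A) /= ?sepA ?cA // lerDl sumr_ge0.
pose D := m.+1.
have [X [XS X_le]] := @integral_cover realR m (is_separator e sigma s t) x (9 * D) x0 xS.
have [p [pP p_le]] := short X D isT XS.
have D0 : 0 < D%:R :> realR by rewrite ltr0n.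
have mD : m%:R <= D%:R :> realR by rewrite ler_nat leqnSn.
have pk : k%:R <= #|path_colors sigma s p|%:R :> realR by rewrite ler_nat k_min.
have pR : D%:R * #|path_colors sigma s p|%:R <= 3 * (\sum_c X c)%:R :> realR.
  by rewrite -!natrM ler_nat.
rewrite -(ler_pM2l D0); have := ler_wpM2l (ltW D0) pk.
have := ler_wpM2l (ltW D0) x_le; have := ler_wpM2l (ltW D0) tau1.
by move: X_le; rewrite natrM -!mulrA; lra.
Qed.

End MinColorPathBounds.

Theorem theorem1p4 :
  exists c1 c2 : realR, 0 < c1 /\ c1 <= c2 /\
  forall (V : finType) (e : rel V) (m : nat) (sigma : V -> {set 'I_m}) (s t : V),
    symmetric e -> planar e -> color_connected e sigma -> connect e s t ->
    forall (OPT : nat) (tau : realR),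
      is_OPT e sigma s t OPT -> is_tau e sigma s t tau ->
      c1 * tau <= OPT%:R <= c2 * tau.
Proof.
exists 1, 57; split; first exact: ltr01.
split; first by rewrite ler1n.
move=> V e m sigma s t e_sym e_planar colors st OPT tau optP tauP.
apply/andP; split; last exact: opt_le_tau optP tauP.
rewrite mul1r; have [[p [pP <-]] _] := optP; have [[y [yP <-]] _] := tauP.
exact: packing_le_colors.
Qed.
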